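(* Let $X=\operatorname{Proj} S$ be a smooth projective curve over a field $K$ of characteristic $0$, where $S$ is a normal $2$-dimensional standard graded $K$-domain. Let $n,m,q\in\mathbb{N}_{>0}$, $e_1,\dots,e_n,d_1,\dots,d_m\in\mathbb{Z}$, and let $$A:\bigoplus_{i=1}^n\mathcal{O}_X(-e_i)\longrightarrow\bigoplus_{j=1}^m\mathcal{O}_X(-d_j)$$ be the map given by an $m\times n$ matrix with entries $A_{j,i}\in S_{e_i-d_j}$. Let $\mathcal{F}=\ker A$, so that $0\to\mathcal{F}\to\bigoplus_{i}\mathcal{O}_X(-e_i)\to\bigoplus_j\mathcal{O}_X(-d_j)$ is exact. (1) $\operatorname{Sym}^q\mathcal{F}=\ker A_q$, where $$A_q:\operatorname{Sym}^q\Big(\bigoplus_{i=1}^n\mathcal{O}_X(-e_i)\Big)=\bigoplus_{a\in I}\mathcal{O}_X(-a\cdot e)\longrightarrow\Big(\operatorname{Sym}^{q-1}\Big(\bigoplus_{i=1}^n\mathcal{O}_X(-e_i)\Big)\Big)\otimes\bigoplus_{j=1}^m\mathcal{O}_X(-d_j)=\bigoplus_{(b,j)\in J}\mathcal{O}_X(-b\cdot e-d_j)$$ is the map given by the following matrix. Its columns are indexed by $I=\{a=(a_1,\dots,a_n)\in\mathbb{N}^n:\sum_{i=1}^n a_i=q\}$, its rows by $J=\{(b,j)=(b_1,\dots,b_n,j)\in\mathbb{N}^{n+1}:\sum_{i=1}^n b_i=q-1,\ 1\leq j\leq m\}$, and its entries are $$A_{q,(b,j),a}=\begin{cases}0,&\text{if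 there is } i\in\{1,\dots,n\}\text{ with } b_i>a_i,\\ a_{i^*}\cdot A_{j,i^*},&\text{otherwise, where } i^*\text{ is the unique index with } a_{i^*}>b_{i^*}.\end{cases}$$ (2) $\bigwedge^q\mathcal{F}=\ker A_{\bigwedge^q}$, where $$A_{\bigwedge^q}:\bigwedge^q\Big(\bigoplus_{i=1}^n\mathcal{O}_X(-e_i)\Big)\longrightarrow\Big(\bigwedge^{q-1}\Big(\bigoplus_{i=1}^n\mathcal{O}_X(-e_i)\Big)\Big)\otimes\bigoplus_{j=1}^m\mathcal{O}_X(-d_j)$$ is the map given by the following matrix. Its columns are indexed by the subsets $I\subseteq\{1,\dots,n\}$ with $\#I=q$, its rows by the pairs $(J,j)$ with $J\subseteq\{1,\dots,n\}$, $\#J=q-1$ and $1\leq j\leq m$, and its entries are $$A_{\bigwedge^q,(J,j),I}=\begin{cases}0,&\text{if } J\not\subset I,\\ \operatorname{sign}(i^*,I)\cdot A_{j,i^*},&\text{otherwise, where } i^*\text{ is the unique element of } I\setminus J.\end{cases}$$ Here $\operatorname{sign}(i^*,I)=(-1)^{\operatorname{pos}(i^* )}$, where $\operatorname{pos}(i^* )$ is the position of $i^*$ in $I$ with respect to the order induced from $\{1,\dots,n\}$.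
   Context: $\mathbb{N}$ contains $0$. For $a\in\mathbb{N}^n$, $a\cdot e=\sum_{i=1}^n a_ie_i$. Symmetric and exterior powers of direct sums of twists are decomposed in the standard way: $\operatorname{Sym}^q(\bigoplus_{i=1}^n\mathcal{O}_X(-e_i))=\bigoplus_{a\in\mathbb{N}^n,\ \sum a_i=q}\mathcal{O}_X(-\sum_i a_ie_i)$ (the summand of $a$ corresponding to the monomial $u_1^{a_1}\cdots u_n^{a_n}$ in the local generators $u_i$ of the summands), and $\bigwedge^q(\bigoplus_{i=1}^n\mathcal{O}_X(-e_i))=\bigoplus_{I\subseteq\{1,\dots,n\},\#I=q}\mathcal{O}_X(-\sum_{i\in I}e_i)$ (the summand of $I=\{i_1<\dots<i_q\}$ corresponding to $u_{i_1}\wedge\dots\wedge u_{i_q}$). $S_d$ denotes the degree-$d$ part of $S$, which equals $\Gamma(X,\mathcal{O}_X(d))$. The equalities $\operatorname{Sym}^q\mathcal{F}=\ker A_q$ and $\bigwedge^q\mathcal{F}=\ker A_{\bigwedge^q}$ mean that the maps $\operatorname{Sym}^q\mathcal{F}\to\operatorname{Sym}^q(\bigoplus_i\mathcal{O}_X(-e_i))$ and $\bigwedge^q\mathcal{F}\to\bigwedge^q(\bigoplus_i\mathcal{O}_X(-e_i))$ induced by the inclusion of $\mathcal{F}$ identify the sources with the respective kernels. A standard graded $K$-domain is a graded integral domain with degree-zero part $K$, generated over $K$ by finitely many elements of degree $1$. *)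

(* Defs.v *)
From HB Require Import structures.
From mathcomp Require Import all_boot all_order all_algebra all_fingroup.
From mathcomp Require Import mathcomp_extra boolp classical_sets functions.
From mathcomp Require Import topology.
From mathcomp Require Import ring.

Set Implicit Arguments.
Unset Strict Implicit.
Unset Printing Implicit Defensive.

Import GRing.Theory Num.Theory.
Local Open Scope classical_set_scope.
Local Open Scope ring_scope.

Local Notation "x %:F" := (FracField.tofrac x).

Record standardGradedDomain (K : fieldType) := StandardGradedDomain {
  sgd_ring :> idomainType;
  sgd_struct : {rmorphism K -> sgd_ring};
  sgd_part : nat -> set sgd_ring;
  sgd_part_zero : forall d, sgd_part d 0;
  sgd_partB : forall d x y,
    sgd_part d x -> sgd_part d y -> sgd_part d (x - y);
  sgd_partM : forall d e x y,
    sgd_part d x -> sgd_part e y -> sgd_part (d + e)%N (x * y);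
  sgd_part0 : sgd_part 0%N = range sgd_struct;
  sgd_decomp : forall x, exists N (y : 'I_N -> sgd_ring),
    (forall i : 'I_N, sgd_part i (y i)) /\ x = \sum_i y i;
  sgd_direct : forall N (y : 'I_N -> sgd_ring),
    (forall i : 'I_N, sgd_part i (y i)) -> \sum_i y i = 0 -> forall i, y i = 0;
  (* the K-subalgebra generated by [gens] is the whole ring *)
  sgd_gen : exists gens : seq sgd_ring,
    (forall x, x \in gens -> sgd_part 1%N x) /\
    (forall T : set sgd_ring,
       (forall c, T (sgd_struct c)) -> (forall x, x \in gens -> T x) ->
       (forall x y, T x -> T y -> T (x + y)) ->
       (forall x y, T x -> T y -> T (x * y)) ->
       forall x, T x)
}.

Definition is_normal (R : idomainType) : Prop :=
  forall z : {fraction R}, integralOver (@FracField.tofrac R) z ->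
    exists x, z = x%:F.

Definition is_prime (R : nzRingType) (p : set R) : Prop :=
  idealr_closed [in p] /\ prime_idealr_closed [in p].

Definition has_prime_chain (R : nzRingType) (n : nat) : Prop :=
  exists p : nat -> set R, (forall i, (i <= n)%N -> is_prime (p i)) /\
                           (forall i, (i < n)%N -> p i `<` p i.+1).

Definition krull_dim (R : nzRingType) (n : nat) : Prop :=
  has_prime_chain R n /\ ~ has_prime_chain R n.+1.

Record opens (X : topologicalType) :=
  Opens { ocar :> set X; ocar_open : open ocar }.

(* A presheaf of sets, each set of sections being a quotient of [psec] by
   [peqv]. *)
Record presheaf (X : topologicalType) := Presheaf {
  psec : opens X -> Type;
  peqv : forall U, psec U -> psec U -> Prop;
  pres : forall U V : opens X, ocar V `<=` ocar U -> psec U -> psec V;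
  peqv_refl : forall U (s : psec U), peqv s s;
  peqv_sym : forall U (s t : psec U), peqv s t -> peqv t s;
  peqv_trans : forall U (s t u : psec U), peqv s t -> peqv t u -> peqv s u;
  peqv_res : forall (U V : opens X) (h : ocar V `<=` ocar U) (s t : psec U),
    peqv s t -> peqv (pres h s) (pres h t);
  pres_id : forall (U : opens X) (h : ocar U `<=` ocar U) (s : psec U),
    peqv (pres h s) s;
  pres_comp : forall (U V W : opens X) (h : ocar V `<=` ocar U)
      (h' : ocar W `<=` ocar V) (h'' : ocar W `<=` ocar U) (s : psec U),
    peqv (pres h' (pres h s)) (pres h'' s)
}.
Arguments peqv {X} p {U}.
Arguments pres {X} p {U V}.

Section Sheafification.
Variables (X : topologicalType) (P : presheaf X).

Definition local_section := {U : opens X & psec P U}.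

Definition same_germ (x : X) (s t : local_section) : Prop :=
  exists (W : opens X) (hs : ocar W `<=` ocar (tag s))
         (ht : ocar W `<=` ocar (tag t)),
    ocar W x /\ peqv P (pres P hs (tagged s)) (pres P ht (tagged t)).

(* The germ of [s] at [x] (a point of the domain of [s]), as an equivalence
   class; the stalk at [x] is the set of these classes. *)
Definition germ (x : X) (s : local_section) : set local_section :=
  [set t | same_germ x s t].

(* Sections over [U] of the sheaf associated to [P]: families of germs
   indexed by the points of [U], locally given by sections of [P]. Families
   on [U] are extended by the value [set0] (which is not a germ) off [U]. *)
Definition sheafified (U : opens X) : set (X -> set local_section) :=
  [set s | (forall x, ~ ocar U x -> s x = set0) /\
    (forall x, ocar U x -> exists (V : opens X) (t : psec P V),
       [/\ ocar V x, ocar V `<=` ocar U &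
           forall y, ocar V y -> s y = germ y (existT _ V t)])].

(* The map induced on the associated sheaf by a map from [P] to a sheaf of
   [W]-valued functions (extended by 0): evaluate at each [x] a
   representative of the germ at [x]. *)
Definition sheaf_lift (W : zmodType) (f : forall U, psec P U -> X -> W)
    (s : X -> set local_section) : X -> W :=
  fun x => match pselect (exists t, s x t) with
           | left h => f _ (tagged (projT1 (cid h))) x
           | right _ => 0
           end.

End Sheafification.
Arguments sheafified {X} P U.
Arguments sheaf_lift {X} P {W} f s.

Variant power_kind := SymPower | ExtPower.

Section Powers.
Variables (kd : power_kind) (R : comPzRingType) (M : lmodType R) (q : nat).

(* [:: (r_1, m_1); ...] stands for the sum of the r_k m_k(0) ... m_k(q-1). *)
Definition formal_sum := seq (R * {ffun 'I_q -> M}).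

Definition subst_slot (m : {ffun 'I_q -> M}) (i : 'I_q) (x : M) :
  {ffun 'I_q -> M} := [ffun k => if k == i then x else m k].

(* Equality in the quotient of the q-th tensor power of M over R by the
   relations defining the symmetric, resp. exterior, power. *)
Inductive power_eq : formal_sum -> formal_sum -> Prop :=
| power_refl t : power_eq t t
| power_sym t u : power_eq t u -> power_eq u t
| power_trans t u v : power_eq t u -> power_eq u v -> power_eq t v
| power_cat t t' u u' :
    power_eq t t' -> power_eq u u' -> power_eq (t ++ u) (t' ++ u')
| power_catC t u : power_eq (t ++ u) (u ++ t)
| power_coef0 m : power_eq [:: (0, m)] [::]
| power_coefD r s m : power_eq [:: (r + s, m)] [:: (r, m); (s, m)]
| power_slotD r m i x y :
    power_eq [:: (r, subst_slot m i (x + y))]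
             [:: (r, subst_slot m i x); (r, subst_slot m i y)]
| power_slotZ r m i (a : R) x :
    power_eq [:: (r, subst_slot m i (a *: x))]
             [:: (r * a, subst_slot m i x)]
| power_perm r (m : {ffun 'I_q -> M}) (s : 'S_q) : kd = SymPower ->
    power_eq [:: (r, m)] [:: (r, [ffun k => m (s k)])]
| power_alt r (m : {ffun 'I_q -> M}) i j : kd = ExtPower ->
    i != j -> m i = m j ->
    power_eq [:: (r, m)] [::].

End Powers.

Definition fsum_map (R R' : comPzRingType) (M : lmodType R) (M' : lmodType R')
    (q : nat) (g : R -> R') (f : M -> M') (t : formal_sum M q) :
    formal_sum M' q :=
  [seq (g x.1, [ffun k => f (x.2 k)]) | x : R * {ffun 'I_q -> M} <- t].

Section FsumMap.
Variables (R R' : comPzRingType) (M : lmodType R) (M' : lmodType R') (q : nat).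
Variables (g : R -> R') (f : M -> M').
Hypothesis (g0 : g 0 = 0) (gD : {morph g : x y / x + y})
  (gM : {morph g : x y / x * y}) (fD : {morph f : x y / x + y})
  (fZ : forall a x, f (a *: x) = g a *: f x).

Lemma subst_slot_map (m : {ffun 'I_q -> M}) i x :
  [ffun k => f (subst_slot m i x k)] =
  subst_slot [ffun k => f (m k)] i (f x).
Proof. by apply/ffunP => k; rewrite !ffunE; case: eqP. Qed.

Lemma fsum_map_eq kd (t u : formal_sum M q) :
  power_eq kd t u -> power_eq kd (fsum_map g f t) (fsum_map g f u).
Proof.
elim=> {t u}.
- by move=> t; apply: power_refl.
- by move=> t u _ h; apply: power_sym.
- by move=> t u v _ h _ h'; apply: power_trans h h'.
- by move=> t t' u u' _ h _ h'; rewrite /fsum_map !map_cat; apply: power_cat.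
- by move=> t u; rewrite /fsum_map !map_cat; apply: power_catC.
- by move=> m; rewrite /fsum_map /= g0; apply: power_coef0.
- by move=> r s m; rewrite /fsum_map /= gD; apply: power_coefD.
- move=> r m i x y; rewrite /fsum_map /= !subst_slot_map fD.
  exact: power_slotD.
- move=> r m i a x; rewrite /fsum_map /= !subst_slot_map fZ gM.
  exact: power_slotZ.
- move=> r m s ks; rewrite /fsum_map /=.
  have -> : [ffun k => f ([ffun k0 => m (s k0)] k)] =
            [ffun k => [ffun k => f (m k)] (s k)] :> {ffun 'I_q -> M'}.
    by apply/ffunP => k; rewrite !ffunE.
  exact: power_perm.
- move=> r m i j ks ij mij; rewrite /fsum_map /=.
  by apply: (@power_alt _ _ _ _ _ _ i j) => //; rewrite !ffunE mij.
Qed.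

End FsumMap.

Lemma power_eq_sum kd (R L : comPzRingType) (M : lmodType R) q (g : R -> L)
    (G : {ffun 'I_q -> M} -> L) (t u : formal_sum M q) :
  g 0 = 0 -> {morph g : x y / x + y} -> {morph g : x y / x * y} ->
  (forall m i x y, G (subst_slot m i (x + y)) =
                   G (subst_slot m i x) + G (subst_slot m i y)) ->
  (forall m i a x, G (subst_slot m i (a *: x)) = g a * G (subst_slot m i x)) ->
  (kd = SymPower -> forall (m : {ffun 'I_q -> M}) (s : 'S_q), G [ffun k => m (s k)] = G m) ->
  (kd = ExtPower -> forall (m : {ffun 'I_q -> M}) i j,
     i != j -> m i = m j -> G m = 0) ->
  power_eq kd t u ->
  \sum_(x <- (t : seq (R * {ffun 'I_q -> M}))) g x.1 * G x.2 =
  \sum_(x <- (u : seq (R * {ffun 'I_q -> M}))) g x.1 * G x.2.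
Proof.
move=> g0 gD gM GD GZ Gs Ga; elim=> {t u}.
- by [].
- by [].
- by move=> t u v _ -> _ ->.
- by move=> t t' u u' _ h _ h'; rewrite !big_cat /= h h'.
- by move=> t u; rewrite !big_cat /= addrC.
- by move=> m; rewrite !(big_cons, big_nil) ?addr0 g0 mul0r.
- by move=> r s m; rewrite !(big_cons, big_nil) !addr0 /= gD mulrDl.
- by move=> r m i x y; rewrite !(big_cons, big_nil) !addr0 /= GD mulrDr.
- by move=> r m i a x; rewrite !(big_cons, big_nil) !addr0 /= GZ gM mulrA.
- by move=> r m s ks; rewrite !(big_cons, big_nil) !addr0 /= Gs.
- by move=> r m i j ks ij mij; rewrite !(big_cons, big_nil) ?addr0 /= (Ga ks m i j) // mulr0.
Qed.

Section Proj.
Variables (K : fieldType) (S : standardGradedDomain K).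

Definition hpart (d : int) : set S :=
  match d with Posz k => sgd_part k | Negz _ => [set 0] end.

Lemma hpart0 d : hpart d 0.
Proof. by case: d => [k|k] //=; apply: sgd_part_zero. Qed.

Lemma hpartB d x y : hpart d x -> hpart d y -> hpart d (x - y).
Proof. by case: d => [k|k] /=; [apply: sgd_partB | move=> -> ->; rewrite subrr]. Qed.

Lemma hpartN d x : hpart d x -> hpart d (- x).
Proof. by move=> hx; rewrite -[- x]add0r; apply: hpartB => //; apply: hpart0. Qed.

Lemma hpartD d x y : hpart d x -> hpart d y -> hpart d (x + y).
Proof. by move=> hx hy; rewrite -[y]opprK; apply: hpartB => //; apply: hpartN. Qed.

Lemma hpartM d e x y : hpart d x -> hpart e y -> hpart (d + e) (x * y).
Proof.
case: d => [k|k]; last by move=> /= ->; rewrite mul0r => _; apply: hpart0.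
case: e => [l|l]; last by move=> /= _ ->; rewrite mulr0; apply: hpart0.
exact: sgd_partM.
Qed.

Lemma hpart1 : hpart 0 1.
Proof.
change (sgd_part 0%N (1 : S)).
by rewrite sgd_part0; exists 1 => //; rewrite rmorph1.
Qed.

Lemma hpart_sum d (I : Type) (r : seq I) (P : pred I) (F : I -> S) :
  (forall i, P i -> hpart d (F i)) -> hpart d (\sum_(i <- r | P i) F i).
Proof.
by move=> h; elim/big_ind: _ => //; [apply: hpart0 | move=> x y; apply: hpartD].
Qed.

Record proj_space := ProjPoint {
  proj_ideal : set S;
  proj_prime : is_prime proj_ideal;
  proj_homogeneous : forall N (y : 'I_N -> S),
    (forall i : 'I_N, sgd_part i (y i)) ->
    proj_ideal (\sum_i y i) -> forall i, proj_ideal (y i);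
  proj_relevant : exists d x, [/\ (0 < d)%N, sgd_part d x & ~ proj_ideal x]
}.

Lemma proj_idealM (p : proj_space) x y :
  ~ proj_ideal p x -> ~ proj_ideal p y -> ~ proj_ideal p (x * y).
Proof.
case: (proj_prime p) => _ hp hx hy hxy.
by have /orP[/set_mem|/set_mem] := hp x y (mem_set hxy).
Qed.

Lemma proj_idealMl (p : proj_space) x y : proj_ideal p y -> proj_ideal p (x * y).
Proof.
case: (proj_prime p) => -[h0 _ h] _ hy.
have := h x y 0; rewrite addr0 => h'; apply: set_mem; apply: h' => //.
exact: mem_set.
Qed.

Lemma proj_ideal1 (p : proj_space) : ~ proj_ideal p 1.
Proof. by case: (proj_prime p) => -[_ h _] _ h1; move/negP: h; apply; exact: mem_set. Qed.

Lemma proj_ideal0 (p : proj_space) : proj_ideal p 0.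
Proof. by case: (proj_prime p) => -[h _ _] _; apply: set_mem. Qed.

Lemma proj_neq0 (p : proj_space) x : ~ proj_ideal p x -> x%:F != 0 :> {fraction S}.
Proof.
move=> h; rewrite tofrac_eq0; apply: contra_notN h => /eqP ->.
exact: proj_ideal0.
Qed.

(* Complements of the sets V(T), with T a set of homogeneous elements. *)
Definition zariski_open : set_system proj_space :=
  [set U | exists2 T : set S, (forall x, T x -> exists d, hpart d x) &
           U = [set p | exists2 x, T x & ~ proj_ideal p x]].

Lemma zariski_openT : zariski_open setT.
Proof.
exists [set x | exists d, hpart d x] => //.
rewrite eqEsubset; split=> // p _ /=; exists 1; last exact: proj_ideal1.
by exists 0; apply: hpart1.
Qed.

Lemma zariski_openI : setI_closed zariski_open.
Proof.
move=> _ _ [T hT ->] [T' hT' ->].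
exists [set x | exists y z, [/\ T y, T' z & x = y * z]].
  move=> _ [y [z [/hT[d hd] /hT'[e he] ->]]].
  by exists (d + e); apply: hpartM.
rewrite eqEsubset; split=> p /=.
  move=> [[x Tx px] [y Ty py]]; exists (x * y); first by exists x, y.
  exact: proj_idealM.
move=> [_ [x [y [Tx Ty ->]]] pxy]; split.
  by exists x => // px; apply: pxy; rewrite mulrC; apply: proj_idealMl.
by exists y => // py; apply: pxy; apply: proj_idealMl.
Qed.

Lemma zariski_open_bigU (I : Type) (f : I -> set proj_space) :
  (forall i, zariski_open (f i)) -> zariski_open (\bigcup_i f i).
Proof.
move=> hf.
pose g i := projT1 (cid2 (hf i)).
have gh i x : g i x -> exists d, hpart d x.
  by rewrite /g; case: cid2 => T hT _ /=; apply: hT.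
have gf i : f i = [set p | exists2 x, g i x & ~ proj_ideal p x].
  by rewrite /g; case: cid2.
exists (\bigcup_i g i); first by move=> x [i _]; apply: gh.
rewrite eqEsubset; split=> p.
  by move=> [i _]; rewrite gf => -[x gx px]; exists x => //; exists i.
by move=> [x [i _ gx] px]; exists i => //; rewrite gf; exists x.
Qed.

HB.instance Definition _ := gen_eqMixin proj_space.
HB.instance Definition _ := gen_choiceMixin proj_space.
HB.instance Definition _ :=
  isOpenTopological.Build proj_space zariski_openT zariski_openI zariski_open_bigU.

Local Notation L := {fraction S}.
Local Notation ext0 U f := (patch (fun=> 0) (ocar U) f).

(* Sections over [U] of O_X(d), X = Proj S. As S is a domain, all the
   S(d)_(p) lie in its fraction field, and a section is a map to the fraction
   field which is locally a quotient a/f of homogeneous elements with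
   deg a = deg f + d. Functions on [U] are extended by 0 off [U]. *)
Definition twist (d : int) (U : set proj_space) : set (proj_space -> L) :=
  [set s | (forall p, ~ U p -> s p = 0) /\
    (forall p, U p -> exists V : set proj_space, [/\ open V, V p, V `<=` U &
       exists (k : int) (a f : S), [/\ hpart (k + d) a, hpart k f &
         forall y, V y -> ~ proj_ideal y f /\ s y = a%:F / f%:F]])].

Lemma twist0 d (U : opens proj_space) : twist d (ocar U) (fun=> 0).
Proof.
split=> // p Up; exists (ocar U); split=> //; first exact: ocar_open.
exists 0, 0, 1; split; [exact: hpart0|exact: hpart1|move=> y _; split].
  exact: proj_ideal1.
by rewrite tofrac0 mul0r.
Qed.

Lemma twistD d (U : set proj_space) s t :
  twist d U s -> twist d U t -> twist d U (fun p => s p + t p).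
Proof.
move=> [s0 sl] [t0 tl]; split=> [p Up|p Up]; first by rewrite s0 // t0 // addr0.
have [V [oV Vp VU [k [a [f [ha hf e]]]]]] := sl p Up.
have [V' [oV' Vp' VU' [k' [a' [f' [ha' hf' e']]]]]] := tl p Up.
exists (V `&` V'); split=> //; [exact: openI|by move=> y [/VU]|].
exists (k + k'), (a * f' + a' * f), (f * f'); split.
- apply: hpartD.
    by have := hpartM ha hf'; congr hpart; ring.
  by have := hpartM ha' hf; congr hpart; ring.
- exact: hpartM.
- move=> y [Vy Vy'] /=; have [yf ->] := e y Vy; have [yf' ->] := e' y Vy'.
  split; first exact: proj_idealM.
  by rewrite tofracD !tofracM addf_div ?(proj_neq0 yf) ?(proj_neq0 yf').
Qed.

Lemma twistM d d' (U : set proj_space) s t :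
  twist d U s -> twist d' U t -> twist (d + d') U (fun p => s p * t p).
Proof.
move=> [s0 sl] [t0 tl]; split=> [p Up|p Up]; first by rewrite s0 // mul0r.
have [V [oV Vp VU [k [a [f [ha hf e]]]]]] := sl p Up.
have [V' [oV' Vp' VU' [k' [a' [f' [ha' hf' e']]]]]] := tl p Up.
exists (V `&` V'); split=> //; [exact: openI|by move=> y [/VU]|].
exists (k + k'), (a * a'), (f * f'); split.
- by have := hpartM ha ha'; congr hpart; ring.
- exact: hpartM.
- move=> y [Vy Vy'] /=; have [yf ->] := e y Vy; have [yf' ->] := e' y Vy'.
  split; first exact: proj_idealM.
  by rewrite !tofracM mulf_div.
Qed.

Lemma twistN d (U : set proj_space) s : twist d U s -> twist d U (fun p => - s p).
Proof.
move=> [s0 sl]; split=> [p Up|p Up]; first by rewrite s0 // oppr0.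
have [V [oV Vp VU [k [a [f [ha hf e]]]]]] := sl p Up.
exists V; split=> //; exists k, (- a), f; split=> //; first exact: hpartN.
by move=> y /e [yf ey] /=; rewrite ey tofracN mulNr.
Qed.

Lemma twist_res d (U V : opens proj_space) s : ocar V `<=` ocar U ->
  twist d (ocar U) s -> twist d (ocar V) (ext0 V s).
Proof.
move=> VU [s0 sl]; split=> [p Vp|p Vp].
  by rewrite /patch memNset.
have [W [oW Wp WU [k [a [f [ha hf e]]]]]] := sl p (VU _ Vp).
exists (ocar V `&` W); split=> //.
- by apply: openI => //; exact: ocar_open.
- exists k, a, f; split=> // y [Vy Wy]; have [yf ey] := e y Wy.
  by split=> //; rewrite /patch mem_set.
Qed.

Lemma twist_hom d (U : opens proj_space) (x : S) : hpart d x ->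
  twist d (ocar U) (ext0 U (fun=> x%:F)).
Proof.
move=> hx; split=> [p Up|p Up]; first by rewrite /patch memNset.
exists (ocar U); split=> //; first exact: ocar_open.
exists 0, x, 1; split; rewrite ?add0r //; first exact: hpart1.
move=> y Uy; split; first exact: proj_ideal1.
by rewrite /patch mem_set // tofrac1 divr1.
Qed.

Definition in_reg (U : opens proj_space) : {pred proj_space -> L} :=
  [pred s | `[< twist 0 (ocar U) s >]].

Lemma in_regP U s : reflect (twist 0 (ocar U) s) (s \in in_reg U).
Proof. exact: asboolP. Qed.

Definition reg (U : opens proj_space) := {s : proj_space -> L | s \in in_reg U}.
HB.instance Definition _ U := SubChoice.on (reg U).

Lemma regP U (s : reg U) : twist 0 (ocar U) (val s).
Proof. exact/in_regP/(valP s). Qed.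

Lemma in_reg_closed U : zmod_closed (in_reg U).
Proof.
split; first exact/in_regP/twist0.
move=> s t /in_regP hs /in_regP ht.
by apply/in_regP; apply: twistD => //; apply: twistN.
Qed.
HB.instance Definition _ U :=
  GRing.isZmodClosed.Build _ (in_reg U) (in_reg_closed U).
HB.instance Definition _ U := [SubChoice_isSubZmodule of reg U by <:].

Section Reg.
Variable U : opens proj_space.

Lemma reg1_subproof : ext0 U (fun=> 1) \in in_reg U.
Proof.
by apply/in_regP; rewrite -(tofrac1 S); apply: twist_hom; apply: hpart1.
Qed.
Definition reg1 : reg U := exist (fun s => s \in in_reg U) _ reg1_subproof.

Lemma regM_subproof (s t : reg U) : (fun p => val s p * val t p) \in in_reg U.
Proof.
apply/in_regP; rewrite -[X in twist X](addr0 0).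
by apply: twistM; apply: regP.
Qed.
Definition regM (s t : reg U) : reg U :=
  exist (fun s => s \in in_reg U) _ (regM_subproof s t).

Lemma reg_eq (s t : reg U) : val s =1 val t -> s = t.
Proof. by move=> h; apply: val_inj; apply/funext. Qed.

Lemma regMA : associative regM.
Proof. by move=> s t u; apply: reg_eq => p /=; rewrite mulrA. Qed.
Lemma regMC : commutative regM.
Proof. by move=> s t; apply: reg_eq => p /=; rewrite mulrC. Qed.
Lemma reg1M : left_id reg1 regM.
Proof.
move=> s; apply: reg_eq => p /=; rewrite /patch; case: ifPn => [_|].
  by rewrite mul1r.
by rewrite notin_setE => Up; rewrite mul0r (regP s).1.
Qed.
Lemma regMDl : left_distributive regM +%R.
Proof. by move=> s t u; apply: reg_eq => p /=; rewrite mulrDl. Qed.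

HB.instance Definition _ :=
  GRing.Zmodule_isComPzRing.Build (reg U) regMA regMC reg1M regMDl.

Lemma val_regM (s t : reg U) p : val (s * t) p = val s p * val t p.
Proof. by []. Qed.
Lemma val_regD (s t : reg U) p : val (s + t) p = val s p + val t p.
Proof. by []. Qed.
Lemma val_reg1 p : ocar U p -> val (1 : reg U) p = 1.
Proof. by move=> Up; rewrite /= /patch mem_set. Qed.

End Reg.

Lemma reg_res_subproof (U V : opens proj_space) (h : ocar V `<=` ocar U)
  (s : reg U) : ext0 V (val s) \in in_reg V.
Proof. by apply/in_regP; apply: (twist_res h); apply: regP. Qed.
Definition reg_res (U V : opens proj_space) (h : ocar V `<=` ocar U) (s : reg U) : reg V :=
  exist (fun s => s \in in_reg V) _ (reg_res_subproof h s).

Lemma reg_resE (U V : opens proj_space) (h : ocar V `<=` ocar U) (s : reg U) p :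
  val (reg_res h s) p = if p \in ocar V then val s p else 0.
Proof. by []. Qed.

Section Kernel.
Variables (I J : finType) (c : I -> int) (M : J -> I -> S).

(* Sections over [U] of the direct sum of the O_X(c i). *)
Definition dsum (U : opens proj_space) : set (proj_space -> {ffun I -> L}) :=
  [set v | forall i, twist (c i) (ocar U) (fun p => v p i)].

(* M acts on column vectors, componentwise in the fraction field. When the
   entries are homogeneous of the right degrees this maps sections to sections
   ([mxact_dsum]). *)
Definition mxact (v : proj_space -> {ffun I -> L}) :
  proj_space -> {ffun J -> L} :=
  fun p => [ffun j => \sum_i (M j i)%:F * v p i].

Definition mxker (U : opens proj_space) : set (proj_space -> {ffun I -> L}) :=
  [set v | dsum U v /\ mxact v = fun=> 0].

Lemma mxactP v :
  mxact v = (fun=> 0) <-> forall p j, \sum_i (M j i)%:F * v p i = 0.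
Proof.
split=> [/funeqP h p j|h].
  by have /ffunP/(_ j) := h p; rewrite !ffunE.
by apply/funext => p; apply/ffunP => j; rewrite !ffunE h.
Qed.

Definition in_mxker (U : opens proj_space) : {pred proj_space -> {ffun I -> L}} :=
  [pred v | `[< mxker U v >]].

Lemma in_mxkerP U v : reflect (mxker U v) (v \in in_mxker U).
Proof. exact: asboolP. Qed.

Definition kersec (U : opens proj_space) :=
  {v : proj_space -> {ffun I -> L} | v \in in_mxker U}.
HB.instance Definition _ U := SubChoice.on (kersec U).

Lemma kersecP U (v : kersec U) : mxker U (val v).
Proof. exact/in_mxkerP/(valP v). Qed.

Lemma in_mxker_closed U : zmod_closed (in_mxker U).
Proof.
split.
  apply/in_mxkerP; split; last first.
    apply/mxactP => p j; rewrite big1 // => i _.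
    by rewrite ffunE mulr0.
  move=> i; have := twist0 (c i) U; congr (twist _ _ _).
  by apply/funext => p; rewrite ffunE.
move=> v w /in_mxkerP [v1 /mxactP v2] /in_mxkerP [w1 /mxactP w2].
apply/in_mxkerP; split; last first.
  apply/mxactP => p j; have := congr2 (fun x y => x - y) (v2 p j) (w2 p j).
  rewrite subrr -sumrB; apply: etrans.
  by apply: eq_bigr => i _; rewrite !ffunE mulrBr.
move=> i; have := twistD (v1 i) (twistN (w1 i)); congr (twist _ _ _).
by apply/funext => p; rewrite !ffunE.
Qed.
HB.instance Definition _ U :=
  GRing.isZmodClosed.Build _ (in_mxker U) (in_mxker_closed U).
HB.instance Definition _ U := [SubChoice_isSubZmodule of kersec U by <:].

Section KerModule.
Variable U : opens proj_space.

Lemma kerZ_subproof (r : reg U) (v : kersec U) :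
  (fun p => [ffun i => val r p * val v p i]) \in in_mxker U.
Proof.
have [v1 /mxactP v2] := kersecP v.
apply/in_mxkerP; split; last first.
  apply/mxactP => p j; have := congr1 ( *%R (val r p)) (v2 p j).
  rewrite mulr0 mulr_sumr; apply: etrans.
  by apply: eq_bigr => i _; rewrite ffunE mulrCA.
move=> i; have := twistM (regP r) (v1 i); rewrite add0r; congr (twist _ _ _).
by apply/funext => p; rewrite !ffunE.
Qed.
Definition kerZ (r : reg U) (v : kersec U) : kersec U :=
  exist (fun s => s \in in_mxker U) _ (kerZ_subproof r v).

Lemma kersec_eq (v w : kersec U) :
  (forall p i, val v p i = val w p i) -> v = w.
Proof.
by move=> h; apply: val_inj; apply/funext => p; apply/ffunP => i; apply: h.
Qed.

Lemma kerZA r s v : kerZ r (kerZ s v) = kerZ (r * s) v.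
Proof. by apply: kersec_eq => p i /=; rewrite !ffunE mulrA. Qed.
Lemma ker1Z : left_id 1 kerZ.
Proof.
move=> v; apply: kersec_eq => p i /=; rewrite !ffunE.
have [Up|Up] := pselect (ocar U p).
  by rewrite /= /patch mem_set // mul1r.
by have [v1 _] := kersecP v; rewrite ((v1 i).1 p Up) mulr0.
Qed.
Lemma kerZDr : right_distributive kerZ +%R.
Proof. by move=> r v w; apply: kersec_eq => p i /=; rewrite !ffunE mulrDr. Qed.
Lemma kerZDl v : {morph kerZ^~ v : r s / r + s}.
Proof. by move=> r s; apply: kersec_eq => p i /=; rewrite !ffunE mulrDl. Qed.

HB.instance Definition _ := GRing.Zmodule_isLmodule.Build (reg U) (kersec U)
  kerZA ker1Z kerZDr kerZDl.

End KerModule.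

Lemma val_kerD U (v w : kersec U) p i :
  val (v + w) p i = val v p i + val w p i.
Proof. by rewrite /= ffunE. Qed.

Lemma val_kerZ U (r : reg U) (v : kersec U) p i :
  val (r *: v) p i = val r p * val v p i.
Proof. by rewrite /= ffunE. Qed.

Lemma ker_res_subproof (U V : opens proj_space) (h : ocar V `<=` ocar U)
  (v : kersec U) : ext0 V (val v) \in in_mxker V.
Proof.
have [v1 /mxactP v2] := kersecP v.
apply/in_mxkerP; split.
  move=> i; have := twist_res h (v1 i); congr (twist _ _ _).
  by apply/funext => p; rewrite /patch; case: ifP; rewrite ?ffunE.
apply/mxactP => p j; rewrite /patch; case: ifP => _; first exact: v2.
by rewrite big1 // => i _; rewrite ffunE mulr0.
Qed.
Definition ker_res (U V : opens proj_space) (h : ocar V `<=` ocar U)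
  (v : kersec U) : kersec V :=
  exist (fun s => s \in in_mxker V) _ (ker_res_subproof h v).

Lemma ker_resE (U V : opens proj_space) (h : ocar V `<=` ocar U) (v : kersec U) p i :
  val (ker_res h v) p i = if p \in ocar V then val v p i else 0.
Proof. by rewrite /= /patch; case: ifP; rewrite ?ffunE. Qed.

Section PowerSheaf.
Variables (kd : power_kind) (q : nat).

Definition power_sec (U : opens proj_space) :=
  @formal_sum (reg U) (kersec U) q.

Definition power_res (U V : opens proj_space) (h : ocar V `<=` ocar U) :
  power_sec U -> power_sec V := fsum_map (reg_res h) (ker_res h).

Lemma power_res_eq (U V : opens proj_space) (h : ocar V `<=` ocar U)
  (s t : power_sec U) :
  power_eq kd s t -> power_eq kd (power_res h s) (power_res h t).
Proof.
apply: fsum_map_eq.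
- by apply: reg_eq => p; rewrite reg_resE; case: ifP.
- move=> r s'; apply: reg_eq => p; rewrite val_regD !reg_resE val_regD.
  by case: ifP => //; rewrite addr0.
- move=> r s'; apply: reg_eq => p; rewrite val_regM !reg_resE val_regM.
  by case: ifP => //; rewrite mulr0.
- move=> v w; apply: kersec_eq => p i; rewrite val_kerD !ker_resE val_kerD.
  by case: ifP => //; rewrite addr0.
- move=> r v; apply: kersec_eq => p i.
  rewrite val_kerZ !ker_resE val_kerZ reg_resE.
  by case: ifP => //; rewrite mulr0.
Qed.

Lemma reg_res_comp (U V W : opens proj_space) (h : ocar V `<=` ocar U)
  (h' : ocar W `<=` ocar V) (h'' : ocar W `<=` ocar U) s :
  reg_res h' (reg_res h s) = reg_res h'' s.
Proof.
apply: reg_eq => p /=; rewrite /patch; case: ifP => //.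
by rewrite inE => /h' Vp; rewrite mem_set.
Qed.

Lemma ker_res_comp (U V W : opens proj_space) (h : ocar V `<=` ocar U)
  (h' : ocar W `<=` ocar V) (h'' : ocar W `<=` ocar U) s :
  ker_res h' (ker_res h s) = ker_res h'' s.
Proof.
apply: kersec_eq => p i /=; rewrite /patch; case: ifP => //.
by rewrite inE => /h' Vp; rewrite mem_set.
Qed.

Lemma reg_res_id (U : opens proj_space) (h : ocar U `<=` ocar U) s :
  reg_res h s = s.
Proof.
apply: reg_eq => p /=; rewrite /patch; case: ifPn => //.
by rewrite notin_setE => Up; rewrite (regP s).1.
Qed.

Lemma ker_res_id (U : opens proj_space) (h : ocar U `<=` ocar U) s :
  ker_res h s = s.
Proof.
apply: kersec_eq => p i /=; rewrite /patch; case: ifPn => //.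
rewrite notin_setE => Up; have [v1 _] := kersecP s.
by rewrite ((v1 i).1 p Up) ffunE.
Qed.

Lemma power_res_id (U : opens proj_space) (h : ocar U `<=` ocar U)
  (s : power_sec U) : power_eq kd (power_res h s) s.
Proof.
suff -> : power_res h s = s by apply: power_refl.
rewrite /power_res /fsum_map -[RHS]map_id; apply: eq_map => -[r m] /=.
rewrite reg_res_id; congr (_, _); apply/ffunP => k.
by rewrite ffunE ker_res_id.
Qed.

Lemma power_res_comp (U V W : opens proj_space) (h : ocar V `<=` ocar U)
  (h' : ocar W `<=` ocar V) (h'' : ocar W `<=` ocar U) (s : power_sec U) :
  power_eq kd (power_res h' (power_res h s)) (power_res h'' s).
Proof.
suff -> : power_res h' (power_res h s) = power_res h'' s by apply: power_refl.
rewrite /power_res /fsum_map -map_comp; apply: eq_map => -[r m] /=.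
rewrite (reg_res_comp h h' h''); congr (_, _); apply/ffunP => k.
by rewrite !ffunE (ker_res_comp h h' h'').
Qed.

(* U |-> the q-th symmetric, resp. exterior, power of the O_X(U)-module
   (ker M)(U). *)
Definition power_presheaf : presheaf proj_space :=
  @Presheaf _ power_sec (fun U => @power_eq kd _ _ q) power_res
    (fun U => @power_refl kd _ _ q) (fun U => @power_sym kd _ _ q)
    (fun U => @power_trans kd _ _ q)
    power_res_eq power_res_id power_res_comp.

End PowerSheaf.
End Kernel.

Lemma twist_scale d d' (U : opens proj_space) (x : S) s :
  hpart (d' - d) x -> twist d (ocar U) s ->
  twist d' (ocar U) (fun p => x%:F * s p).
Proof.
move=> hx hs; have := twistM (twist_hom U hx) hs; rewrite subrK.
congr (twist _ _ _); apply/funext => p; rewrite /patch; case: ifPn => //.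
by rewrite notin_setE => Up; rewrite hs.1 // !mulr0.
Qed.

Lemma mxact_dsum (I J : finType) (c : I -> int) (c' : J -> int)
    (M : J -> I -> S) (U : opens proj_space) v :
  (forall j i, hpart (c' j - c i) (M j i)) -> dsum c U v ->
  dsum c' U (mxact M v).
Proof.
move=> hM hv j.
have -> : (fun p => mxact M v p j) = fun p => \sum_i (M j i)%:F * v p i.
  by apply/funext => p; rewrite ffunE.
elim: (index_enum I) => [|i r IH].
  by have := twist0 (c' j) U; congr (twist _ _ _); apply/funext => p; rewrite big_nil.
have := twistD (twist_scale (hM j i) (hv i)) IH; congr (twist _ _ _).
by apply/funext => p; rewrite big_cons.
Qed.

(* The local ring S_(p), as a subring of the fraction field. *)
Definition in_stalk (p : proj_space) : {pred L} :=
  [pred x | `[< exists (k : int) (a f : S), [/\ hpart k a, hpart k f,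
                  ~ proj_ideal p f & x = a%:F / f%:F] >]].

Definition stalk (p : proj_space) := {x : L | x \in in_stalk p}.
HB.instance Definition _ p := SubChoice.on (stalk p).

Lemma in_stalk_closed p : subring_closed (in_stalk p).
Proof.
split.
- apply/asboolP; exists 0, 1, 1; split=> //; try exact: hpart1.
    exact: proj_ideal1.
  by rewrite tofrac1 divr1.
- move=> x y /asboolP [k [a [f [ha hf pf ->]]]].
  move=> /asboolP [l [b [g [hb hg pg ->]]]]; apply/asboolP.
  exists (k + l), (a * g - b * f), (f * g); split.
  + apply: hpartB; first exact: hpartM.
    by rewrite addrC; apply: hpartM.
  + exact: hpartM.
  + exact: proj_idealM.
  + rewrite tofracB !tofracM -mulNr addf_div ?(proj_neq0 pf) ?(proj_neq0 pg) //.
    by rewrite mulNr.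
- move=> x y /asboolP [k [a [f [ha hf pf ->]]]].
  move=> /asboolP [l [b [g [hb hg pg ->]]]]; apply/asboolP.
  exists (k + l), (a * b), (f * g); split; try exact: hpartM.
    exact: proj_idealM.
  by rewrite !tofracM mulf_div.
Qed.
HB.instance Definition _ p :=
  GRing.isSubringClosed.Build _ (in_stalk p) (in_stalk_closed p).
HB.instance Definition _ p := [SubChoice_isSubComNzRing of stalk p by <:].

Definition is_derivation (p : proj_space) (M : lmodType (stalk p))
    (d : stalk p -> M) : Prop :=
  [/\ {morph d : x y / x + y},
      forall x y, d (x * y) = x *: d y + y *: d x &
      forall (c : K) x, val x = (sgd_struct S c)%:F -> d x = 0].

(* (M, d) is the module of Kaehler differentials of the K-algebra S_(p). *)
Definition is_kaehler (p : proj_space) (M : lmodType (stalk p))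
    (d : stalk p -> M) : Prop :=
  is_derivation d /\
  forall (N : lmodType (stalk p)) (D : stalk p -> N), is_derivation D ->
    exists f : {linear M -> N}, D =1 f \o d /\
      forall g : {linear M -> N}, D =1 g \o d -> g =1 f.

(* Proj S is of dimension 1 (in terms of chains of specializations of its
   points), and its sheaf of differentials over K is locally free of rank 1. *)
Definition smooth_curve : Prop :=
  [/\ exists p p' : proj_space, proj_ideal p `<` proj_ideal p',
      ~ exists p p' p'' : proj_space, proj_ideal p `<` proj_ideal p' /\
                                proj_ideal p' `<` proj_ideal p'' &
      forall p, exists d : stalk p -> (stalk p)^o, is_kaehler d].

Section Coordinates.
Variables (n m q : nat) (e : 'I_n -> int) (d : 'I_m -> int) (A : 'M[S]_(m, n)).

Local Notation c := (fun i => - e i).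
Local Notation M := (fun j i => A j i).

(* F(U), as a submodule of the sections of the sum of the O_X(- e_i). *)
Local Notation F := (kersec c M).

(* Multi-indices in N^n of sum k; their entries are at most k. *)
Definition multi (k : nat) :=
  {a : {ffun 'I_n -> 'I_k.+1} | (\sum_i (a i : nat) == k)%N}.
HB.instance Definition _ k := SubFinite.on (multi k).

Definition mdeg k (a : multi k) : int := \sum_i e i *+ val a i.

Definition sym_twists (a : multi q) : int := - mdeg a.

Definition sym_matrix (bj : multi q.-1 * 'I_m) (a : multi q) : S :=
  if [exists i, (val a i < val bj.1 i)%N] then 0
  else if [pick i | (val bj.1 i < val a i)%N] is Some i
       then A bj.2 i *+ val a i else 0.

(* Coefficients on the monomials u^a of a sum of products v_1 ... v_q, with
   v_k = \sum_i (v_k)_i u_i. *)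
Definition sym_coords (U : opens proj_space) (t : power_sec c M q U) :
    proj_space -> {ffun multi q -> L} :=
  fun p => [ffun a : multi q =>
    \sum_(x <- (t : seq (reg U * {ffun 'I_q -> F U})))
    val x.1 p *
    \sum_(f : {ffun 'I_q -> 'I_n} |
            [forall i, #|[pred k | f k == i]| == val a i])
       \prod_k val (x.2 k) p (f k)].

Definition ksubset (k : nat) := {I : {set 'I_n} | #|I| == k}.
HB.instance Definition _ k := SubFinite.on (ksubset k).

(* The elements of I in increasing order. *)
Definition ksubset_elt k (I : ksubset k) (l : 'I_k) : 'I_n :=
  enum_val (cast_ord (esym (eqP (valP I))) l).

Definition ext_twists (I : ksubset q) : int := - \sum_(i in val I) e i.

(* Positions are counted from 1. *)
Definition ksubset_pos (i : 'I_n) (I : {set 'I_n}) : nat :=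
  #|[pred k in I | (k <= i)%N]|.

Definition ext_matrix (Jj : ksubset q.-1 * 'I_m) (I : ksubset q) : S :=
  if val Jj.1 \subset val I then
    if [pick i in val I :\: val Jj.1] is Some i
    then (-1) ^+ ksubset_pos i (val I) * A Jj.2 i else 0
  else 0.

(* Coefficients on the u_{i_1} /\ ... /\ u_{i_q}, i_1 < ... < i_q. *)
Definition ext_coords (U : opens proj_space) (t : power_sec c M q U) :
    proj_space -> {ffun ksubset q -> L} :=
  fun p => [ffun I : ksubset q =>
    \sum_(x <- (t : seq (reg U * {ffun 'I_q -> F U})))
      val x.1 p * \det (\matrix_(k, l) val (x.2 k) p (ksubset_elt I l))].

Lemma sym_coords_eq (U : opens proj_space) (t u : power_sec c M q U) :
  power_eq SymPower t u -> sym_coords t = sym_coords u.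
Proof.
move=> tu; apply/funext => p; apply/ffunP => a; rewrite !ffunE.
pose G (v : {ffun 'I_q -> F U}) : L :=
  \sum_(f : {ffun 'I_q -> 'I_n} | [forall i, #|[pred k | f k == i]| == val a i])
    \prod_k val (v k) p (f k).
apply: (power_eq_sum (g := fun r : reg U => val r p) (G := G) _ _ _ _ _ _ _ tu).
- by [].
- by [].
- by [].
- move=> v i x y; rewrite /G -big_split; apply: eq_bigr => f _.
  rewrite !(bigD1 (P := predT) i) //= !ffunE eqxx val_kerD mulrDl.
  by congr (_ * _ + _ * _); apply: eq_bigr => k ki; rewrite !ffunE (negbTE ki).
- move=> v i r x; rewrite /G mulr_sumr; apply: eq_bigr => f _.
  rewrite !(bigD1 (P := predT) i) //= !ffunE eqxx val_kerZ -mulrA.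
  by congr (_ * (_ * _)); apply: eq_bigr => k ki; rewrite !ffunE (negbTE ki).
- move=> _ v s.
  pose h (f : {ffun 'I_q -> 'I_n}) := [ffun k => f ((s^-1)%g k)].
  pose h' (f : {ffun 'I_q -> 'I_n}) := [ffun k => f (s k)].
  have hK : cancel h h' by move=> f; apply/ffunP => k; rewrite !ffunE permK.
  have hK' : cancel h' h by move=> f; apply/ffunP => k; rewrite !ffunE permKV.
  rewrite /G [RHS](reindex h); last by exists h' => ? _.
  apply: eq_big => [f|f _].
    apply: eq_forallb => i; congr (_ == _).
    rewrite -[LHS](card_imset _ (@perm_inj _ s)).
    apply: eq_card => k; rewrite !inE ffunE; apply/imsetP/idP.
      by move=> [l]; rewrite inE => fl ->; rewrite permK.
    by move=> fk; exists ((s^-1)%g k); rewrite ?inE ?permKV.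
  rewrite [RHS](reindex_inj (@perm_inj _ s)).
  by apply: eq_bigr => k _; rewrite !ffunE permK.
- by [].
Qed.

Lemma ext_coords_eq (U : opens proj_space) (t u : power_sec c M q U) :
  power_eq ExtPower t u -> ext_coords t = ext_coords u.
Proof.
move=> tu; apply/funext => p; apply/ffunP => I; rewrite !ffunE.
pose G (v : {ffun 'I_q -> F U}) : L :=
  \det (\matrix_(k, l) val (v k) p (ksubset_elt I l)).
apply: (power_eq_sum (g := fun r : reg U => val r p) (G := G) _ _ _ _ _ _ _ tu).
- by [].
- by [].
- by [].
- move=> v i x y; rewrite /G.
  rewrite (determinant_multilinear (i0 := i) (b := 1) (c := 1)
    (B := \matrix_(k, l) val (subst_slot v i x k) p (ksubset_elt I l))
    (C := \matrix_(k, l) val (subst_slot v i y k) p (ksubset_elt I l))).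
  + by rewrite !mul1r.
  + by apply/rowP => l; rewrite !mxE !mul1r !ffunE eqxx val_kerD.
  + by apply/matrixP => k l; rewrite !mxE !ffunE eq_sym (negbTE (neq_lift _ _)).
  + by apply/matrixP => k l; rewrite !mxE !ffunE eq_sym (negbTE (neq_lift _ _)).
- move=> v i r x; rewrite /G.
  rewrite (determinant_multilinear (i0 := i) (b := val r p) (c := 0)
    (B := \matrix_(k, l) val (subst_slot v i x k) p (ksubset_elt I l))
    (C := \matrix_(k, l) val (subst_slot v i x k) p (ksubset_elt I l))).
  + by rewrite mul0r addr0.
  + by apply/rowP => l; rewrite !mxE mul0r addr0 !ffunE eqxx val_kerZ.
  + by apply/matrixP => k l; rewrite !mxE !ffunE eq_sym (negbTE (neq_lift _ _)).
  + by apply/matrixP => k l; rewrite !mxE !ffunE eq_sym (negbTE (neq_lift _ _)).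
- by [].
- move=> _ v i j ij vij; apply: (determinant_alternate ij) => l.
  by rewrite !mxE vij.
Qed.

(* The sheaves Sym^q F and Lambda^q F, and the maps induced by the inclusion
   of F into the sum E of the O_X(- e_i), followed by the decomposition of
   Sym^q E, resp. Lambda^q E, as a sum of twists. *)
Definition sym_sheaf (U : opens proj_space) :=
  sheafified (power_presheaf c M SymPower q) U.

Definition sym_map := sheaf_lift (power_presheaf c M SymPower q) sym_coords.

Definition ext_sheaf (U : opens proj_space) :=
  sheafified (power_presheaf c M ExtPower q) U.

Definition ext_map := sheaf_lift (power_presheaf c M ExtPower q) ext_coords.

Lemma ksubset_elt_mono k (I : ksubset k) (l l' : 'I_k) :
  (l < l')%N -> (ksubset_elt I l < ksubset_elt I l')%N.
Proof.
rewrite /ksubset_elt => ll'.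
set x := cast_ord _ l; set y := cast_ord _ l'.
have xy : (x < y)%N by [].
have x0 : 'I_n by exact: (enum_val x).
rewrite !(enum_val_nth x0).
have hs : sorted ltn [seq val i | i <- enum (val I)].
  rewrite /enum_mem -enumT; apply: (subseq_sorted ltn_trans).
    by apply: map_subseq; apply: filter_subseq.
  by rewrite val_enum_ord iota_ltn_sorted.
have sz : size (enum (val I)) = #|val I| by rewrite -cardE.
have hn z : (z < #|val I|)%N ->
    nth 0%N [seq val i | i <- enum (val I)] z = val (nth x0 (enum (val I)) z).
  by move=> hz; rewrite (nth_map x0) // sz.
have := sorted_ltn_nth ltn_trans 0%N hs.
move=> /(_ x y); rewrite !inE !size_map sz !ltn_ord => /(_ isT isT xy).
by rewrite !hn.
Qed.

Hypothesis (q0 : (0 < q)%N)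
  (hA : forall j i, hpart (e i - d j) (A j i)).

Lemma sym_matrix_hom (bj : multi q.-1 * 'I_m) (a : multi q) :
  hpart ((- mdeg bj.1 - d bj.2) - sym_twists a) (sym_matrix bj a).
Proof.
rewrite /sym_matrix /sym_twists; case: ifPn => [_|]; first exact: hpart0.
rewrite negb_exists => /forallP ba.
case: pickP => [i bi|_]; last exact: hpart0.
have le k : (val bj.1 k <= val a k)%N by have := ba k; rewrite -leqNgt.
have sa : (\sum_k (val a k : nat) = q)%N by apply/eqP/(valP a).
have sb : (\sum_k (val bj.1 k : nat) = q.-1)%N by apply/eqP/(valP bj.1).
have S1 : (\sum_k (val a k - val bj.1 k) = 1)%N.
  rewrite sumnB; last by move=> k _; apply: le.
  by rewrite sa sb; case: (q) q0 => // q' _; rewrite subSnn.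
have ak k : val a k = (val bj.1 k + (k == i))%N :> nat.
  rewrite -(subnKC (le k)); congr addn.
  move: S1; rewrite (bigD1 i) //=; move: bi; rewrite -subn_gt0.
  case E : (val a i - val bj.1 i)%N => [//|x] _ S1.
  have x0 : x = 0%N by move: S1; case: (x).
  have [->|ki] := eqVneq k i; first by rewrite E x0.
  move: S1; rewrite x0 add1n => -[/eqP]; rewrite sum_nat_eq0.
  by move=> /forallP/(_ k); rewrite ki => /eqP.
have -> : - mdeg bj.1 - d bj.2 - - mdeg a = e i - d bj.2.
  suff -> : mdeg a = mdeg bj.1 + e i by ring.
  rewrite /mdeg (bigD1 i) //= [\sum_k e k *+ val bj.1 k](bigD1 i) //=.
  rewrite ak eqxx addn1 mulrSr -!addrA; congr (_ + _); rewrite addrC.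
  congr (_ + _); apply: eq_bigr => k ki; by rewrite ak (negbTE ki) addn0.
elim: (val a i : nat) => [|N IH]; first by rewrite mulr0n; apply: hpart0.
by rewrite mulrS; apply: hpartD.
Qed.

Lemma ext_matrix_hom (Jj : ksubset q.-1 * 'I_m) (I : ksubset q) :
  hpart ((- \sum_(i in val Jj.1) e i - d Jj.2) - ext_twists I)
        (ext_matrix Jj I).
Proof.
rewrite /ext_matrix /ext_twists; case: ifPn => [JI|_]; last exact: hpart0.
case: pickP => [i|_]; last exact: hpart0.
move=> iIJ.
have : #|val I :\: val Jj.1| = 1%N.
  rewrite cardsD (finset.setIidPr JI) (eqP (valP I)) (eqP (valP Jj.1)).
  by case: (q) q0 => // q' _; rewrite subSnn.
move=> /eqP/cards1P[i' IJ].
have ei : i' = i by apply/esym/finset.set1P; rewrite -IJ.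
rewrite ei {i' ei} in IJ.
have -> : - \sum_(k in val Jj.1) e k - d Jj.2 - - \sum_(k in val I) e k
          = e i - d Jj.2.
  rewrite [\sum_(k in val I) e k](big_setID (val Jj.1)) /= (finset.setIidPr JI) IJ big_set1.
  ring.
by rewrite -signr_odd; case: odd; rewrite ?expr1 ?mulN1r ?mul1r //; apply: hpartN.
Qed.

End Coordinates.
End Proj.

Arguments sym_sheaf {K S n m} q e A U.
Arguments ext_sheaf {K S n m} q e A U.
Arguments sym_map {K S n m} q e A.
Arguments ext_map {K S n m} q e A.
Arguments sym_matrix {K S n m} q A.
Arguments ext_matrix {K S n m} q A.
Arguments sym_twists {n} q e.
Arguments ext_twists {n} q e.

(* Main.v *)
(* Sections on an open set are maps into the fraction field L of S, and a fraction
   of homogeneous elements is constant, so everything happens in L, with the local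
   rings S_(p) recording where a section is regular. As S is Noetherian (Hilbert),
   normal and of dimension 2, S_(p) is a valuation ring. Hence Gaussian elimination
   on A, with pivots of least valuation, exhibits F near p as the graph of a map
   O^B -> O^(n - B) for some set B of columns; so F is locally free, with
   coordinates indexed by B, and the coordinate of an element of Sym^q F or
   Lambda^q F at a monomial in the generators indexed by B is its coefficient on
   the corresponding product of basis elements. This gives local injectivity.
   Conversely a vector s in the kernel of A_q satisfies, for each b,
   ((b_i + 1) s_(b + 1_i))_i in ker A, so in characteristic 0 the entries of s are
   determined by those at monomials in the generators indexed by B, by induction on
   the number of letters outside B; likewise for the exterior power, up to signs.
   So s is locally the coordinate vector of an element of Sym^q F. *)

Require Import Defs.
From mathcomp Require Import all_boot all_order all_algebra all_fingroup.
From mathcomp Require Import mathcomp_extra boolp classical_sets functions.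
From mathcomp Require Import topology.
From mathcomp Require Import ring.

Set Implicit Arguments.
Unset Strict Implicit.
Unset Printing Implicit Defensive.

Import GRing.Theory Num.Theory.
Local Open Scope classical_set_scope.
Local Open Scope ring_scope.

Local Notation "x %:F" := (FracField.tofrac x).

(** * Noetherian rings and localization at a prime of height one *)

(** The valuation property is proved in the ordinary localization of S at p, where denominators may
    be inhomogeneous, and is carried to homogeneous fractions by taking homogeneous components.
    Twists become trivial near p through powers of an element l of degree 1 outside p, which exists
    because S is generated in degree 1; this is the origin of every factor [l%:F ^ z]. Powers of
    F(U) are given by generators and relations, so nothing is known beforehand about when two formal
    sums differ. The coordinates settle it: products of local basis elements of F span, and the
    coordinates at words in B give back the coefficients, so that equal coordinates force the same
    normal form. Surjectivity comes down to one fact, that a vector in the kernel of the big matrix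
    vanishing at all words in B is zero. Both powers pass through one argument, in which a summand
    is named by a word of q letters and [G] computes the coordinates of a product. *)

Definition is_ideal (R : pzRingType) (I : set R) : Prop :=
  I 0 /\ forall a x y, I x -> I y -> I (a * x + y).

(** Generation is phrased through the ideals containing [s]; explicit linear combinations are one
    instance of [J], taken only for the Cayley-Hamilton argument in [colon_inv]. *)
Definition fg_ideal (R : pzRingType) (I : set R) : Prop :=
  exists2 s : seq R, (forall x, x \in s -> I x) &
    forall J : set R, is_ideal J -> (forall x, x \in s -> J x) -> I `<=` J.

Definition noetherian (R : pzRingType) : Prop :=
  forall I : set R, is_ideal I -> fg_ideal I.

Section Ideals.
Variable R : pzRingType.
Implicit Types I J : set R.

Lemma idealMl I a x : is_ideal I -> I x -> I (a * x).
Proof. by move=> [I0 IM] Ix; rewrite -[a * x]addr0; apply: IM. Qed.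

Lemma idealD I x y : is_ideal I -> I x -> I y -> I (x + y).
Proof. by move=> [I0 IM] Ix Iy; rewrite -[x]mul1r; apply: IM. Qed.

Lemma idealB I x y : is_ideal I -> I x -> I y -> I (x - y).
Proof. by move=> [I0 IM] Ix Iy; rewrite addrC -mulN1r; apply: IM. Qed.

Lemma ideal_sum I (T : Type) (r : seq T) (P : pred T) (F : T -> R) :
  is_ideal I -> (forall i, P i -> I (F i)) -> I (\sum_(i <- r | P i) F i).
Proof.
move=> hI hF; elim/big_ind: _ => //; first by case: hI.
by move=> x y; apply: idealD.
Qed.

Lemma idealI I J : is_ideal I -> is_ideal J -> is_ideal (I `&` J).
Proof.
move=> [I0 IM] [J0 JM]; split=> // a x y [Ix Jx] [Iy Jy].
by split; [apply: IM|apply: JM].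
Qed.

(* The union of a strictly ascending chain of members of [P] would not be
   finitely generated. *)
Lemma noetherian_max (P : set (set R)) :
  noetherian R -> (forall I, P I -> is_ideal I) -> P !=set0 ->
  exists2 I, P I & forall J, P J -> I `<=` J -> J `<=` I.
Proof.
move=> noR idP [I0 PI0]; apply: contrapT => nomax.
have step I : exists J, P I -> [/\ P J, I `<=` J & ~ J `<=` I].
  have [PI|nPI] := pselect (P I); last by exists I.
  apply: contrapT => h; apply: nomax; exists I => // J PJ IJ.
  by apply: contrapT => JI; apply: h; exists J.
have [f hf] := choice step.
pose c n := iter n f I0.
have Pc n : P (c n) by elim: n => //= n IH; case: (hf _ IH).
have cS n : c n `<=` c n.+1 by case: (hf _ (Pc n)).
have cM a b : (a <= b)%N -> c a `<=` c b.
  move=> /subnKC <-; elim: (b - a)%N => [|k IH]; first by rewrite addn0.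
  by rewrite addnS => x /IH; apply: cS.
pose U : set R := [set x | exists n, c n x].
have idU : is_ideal U.
  split; first by exists 0%N; case: (idP _ PI0).
  move=> a x y [k kx] [l ly]; exists (maxn k l).
  apply: (idP _ (Pc _)).2; first by apply: cM kx; apply: leq_maxl.
  by apply: cM ly; apply: leq_maxr.
have [s sU sJ] := noR _ idU.
have [N hN] : exists N, forall x, x \in s -> c N x.
  elim: s sU {sJ} => [|x s IH] sU; first by exists 0%N.
  have [N hN] := IH (fun y ys => sU y (mem_behead (s := x :: s) ys)).
  have [k kx] := sU x (mem_head _ _).
  exists (maxn k N) => y; rewrite inE => /orP[/eqP ->|/hN].
    by apply: cM kx; apply: leq_maxl.
  by apply: cM; apply: leq_maxr.
have [_ _] := hf _ (Pc N); apply => x cx.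
by apply: (sJ _ (idP _ (Pc N)) hN); exists N.+1.
Qed.

End Ideals.

Lemma noetherian_field (K : fieldType) : noetherian K.
Proof.
move=> I [I0 IM].
have [[x [Ix x0]]|h] := pselect (exists x, I x /\ x != 0).
  exists [:: x] => [y|J idJ hJ y _]; first by rewrite inE => /eqP ->.
  by rewrite -(divfK x0 y); apply: (idealMl _ idJ); apply: hJ; rewrite mem_head.
exists [::] => // J [J0 _] _ x Ix.
have [->//|x0] := eqVneq x 0; by case: h; exists x.
Qed.

Lemma noetherian_quotient (R R' : pzRingType) (f : {rmorphism R -> R'}) :
  noetherian R -> (forall y, exists x, f x = y) -> noetherian R'.
Proof.
have pre (I : set R') : is_ideal I -> is_ideal (f @^-1` I).
  move=> [I0 IM]; split; first by rewrite /= rmorph0.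
  by move=> a x y; rewrite /= rmorphD rmorphM; apply: IM.
move=> noR fsurj I idI; have [s sI sJ] := noR _ (pre _ idI).
exists (map f s) => [_ /mapP[x /sI Ix ->]//|J idJ hJ y].
have [x <-] := fsurj y; apply: (sJ _ (pre _ idJ)) => z zs.
by apply: hJ; apply: map_f.
Qed.

(** * Hilbert's basis theorem *)

Section HilbertBasis.
Variable R : comNzRingType.

(** Polynomials of smaller size are allowed and contribute 0, which makes the set an ideal. *)
Definition lead_ideal (I : set {poly R}) (n : nat) : set R :=
  [set c | exists p : {poly R}, [/\ I p, (size p <= n.+1)%N & p`_n = c]].

Lemma lead_ideal_ideal I n : is_ideal I -> is_ideal (lead_ideal I n).
Proof.
move=> [I0 IM]; split; first by exists 0; rewrite size_poly0 coef0.
move=> a x y [p [Ip sp <-]] [q [Iq sq <-]].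
exists (a%:P * p + q); split; first exact: IM.
  apply: leq_trans (size_polyD _ _) _; rewrite geq_max sq andbT.
  by rewrite mul_polyC; apply: leq_trans (size_scale_leq _ _) sp.
by rewrite coefD coefCM.
Qed.

Lemma lead_ideal_le I m n : is_ideal I -> (m <= n)%N ->
  lead_ideal I m `<=` lead_ideal I n.
Proof.
move=> idI mn c [p [Ip sp pc]]; exists ('X^(n - m) * p); split.
- exact: idealMl.
- apply: leq_trans (size_polyMleq _ _) _; rewrite size_polyXn addSn /=.
  by rewrite -[in X in (_ <= X)%N](subnK mn) -addnS leq_add2l.
- by rewrite coefXnM ltnNge leq_subr /= subKn.
Qed.

(** Induction on the size: subtracting a member of [J] with the same top coefficient lowers the size
    and stays in [I]. *)
Lemma lead_ideal_sub I J : is_ideal I -> is_ideal J -> J `<=` I ->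
  (forall n, lead_ideal I n `<=` lead_ideal J n) -> I `<=` J.
Proof.
move=> idI idJ JI h p.
have [n] := ubnP (size p); elim: n p => // n IH p; rewrite ltnS => sp Ip.
case: n IH sp => [|n] IH sp.
  by move: sp; rewrite leqn0 size_poly_eq0 => /eqP ->; case: idJ.
have [q [Jq sq qp]] : lead_ideal J n p`_n by apply: h; exists p.
rewrite -(subrK q p); apply: idealD => //; apply: IH.
  rewrite ltnS; apply/leq_sizeP => j nj; rewrite coefB.
  have [->|jn] := eqVneq j n; first by rewrite qp subrr.
  have lj : (n.+1 <= j)%N by rewrite ltn_neqAle eq_sym jn.
  by rewrite (leq_sizeP _ _ sp) // (leq_sizeP _ _ sq) // subrr.
by apply: idealB => //; apply: JI.
Qed.

(** The ideals of leading coefficients increase with the degree, so the generators of their union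
    all occur by some degree [N], and nothing new appears above it. Lifts of generators in degrees
    up to [N] then generate [I]. *)
Lemma hilbert_basis : noetherian R -> noetherian {poly R}.
Proof.
move=> noR I idI.
have lift n : exists t : seq {poly R}, (forall p, p \in t -> I p) /\
    forall J, is_ideal J -> (forall p, p \in t -> J p) ->
      lead_ideal I n `<=` lead_ideal (I `&` J) n.
  have [s sI sJ] := noR _ (lead_ideal_ideal n idI).
  have ex c : exists p, lead_ideal I n c ->
      [/\ I p, (size p <= n.+1)%N & p`_n = c].
    by have [[p hp]|hc] := pselect (lead_ideal I n c); [exists p|exists 0].
  have [g hg] := choice ex.
  exists (map g s); split=> [_ /mapP[c /sI/hg[? _ _] ->]//|J idJ hJ].
  apply: sJ; first exact: lead_ideal_ideal (idealI idI idJ).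
  move=> c cs; have [Ic sc gc] := hg _ (sI _ cs).
  by exists (g c); split=> //; split=> //; apply: hJ; apply: map_f.
have [t ht] := choice lift.
pose U : set R := [set c | exists n, lead_ideal I n c].
have idU : is_ideal U.
  split; first by exists 0%N; case: (lead_ideal_ideal 0 idI).
  move=> a x y [k kx] [l ly]; exists (maxn k l).
  apply: (lead_ideal_ideal _ idI).2.
  - by apply: (lead_ideal_le idI _ kx); apply: leq_maxl.
  - by apply: (lead_ideal_le idI _ ly); apply: leq_maxr.
have [s sU sJ] := noR _ idU.
have [N hN] : exists N, forall x, x \in s -> lead_ideal I N x.
  elim: s sU {sJ} => [|x s IH] sU; first by exists 0%N.
  have [N hN] := IH (fun y ys => sU y (mem_behead (s := x :: s) ys)).
  have [k kx] := sU x (mem_head _ _).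
  exists (maxn k N) => y; rewrite inE => /orP[/eqP ->|/hN].
    by apply: (lead_ideal_le idI _ kx); apply: leq_maxl.
  by apply: lead_ideal_le => //; apply: leq_maxr.
exists (flatten [seq t n | n <- iota 0 N.+1]).
  by move=> p /flatten_mapP[n _]; apply: (ht n).1.
move=> J idJ hJ.
have hn n : (n <= N)%N -> lead_ideal I n `<=` lead_ideal (I `&` J) n.
  move=> nN; apply: (ht n).2 => // p pt; apply: hJ.
  by apply/flatten_mapP; exists n => //; rewrite mem_iota.
have idIJ := idealI idI idJ.
suff: I `<=` I `&` J by move=> h p /h[].
apply: (lead_ideal_sub idI idIJ) => [p []//|n].
have [nN|/ltnW Nn] := leqP n N; first exact: hn.
move=> c cn; apply: (lead_ideal_le idIJ Nn); apply: hn => //.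
by apply: (sJ _ (lead_ideal_ideal N idI) hN); exists n.
Qed.

End HilbertBasis.

(** An iterated polynomial ring over [K], with one variable per generator, maps onto [S]. *)
Lemma noetherian_fg_algebra (K : fieldType) (S : comNzRingType)
    (iota : {rmorphism K -> S}) (gens : seq S) :
  (forall T : set S, (forall c, T (iota c)) -> (forall x, x \in gens -> T x) ->
     (forall x y, T x -> T y -> T (x + y)) ->
     (forall x y, T x -> T y -> T (x * y)) -> forall x, T x) ->
  noetherian S.
Proof.
move=> gen.
suff [R [f [noR Kf gf]]] : exists (R : comNzRingType) (f : {rmorphism R -> S}),
    [/\ noetherian R, forall c, exists x, f x = iota c &
        forall y, y \in gens -> exists x, f x = y].
  apply: (noetherian_quotient (f := f)) noR _.
  apply: gen => // x y [x' <-] [y' <-].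
    by exists (x' + y'); rewrite rmorphD.
  by exists (x' * y'); rewrite rmorphM.
elim: gens {gen} => [|g gens [R [f [noR Kf gf]]]].
  by exists K, iota; split=> [|c|//]; [apply: noetherian_field|exists c].
have cg : commr_rmorph f g by move=> x; apply: mulrC.
exists {poly R}, (horner_morph cg); split; first exact: hilbert_basis.
  by move=> c; have [x <-] := Kf c; exists x%:P; rewrite /= horner_morphC.
move=> y; rewrite inE => /orP[/eqP ->|/gf[x <-]].
  by exists 'X; rewrite /= horner_morphX.
by exists x%:P; rewrite /= horner_morphC.
Qed.

Lemma is_primeP (R : nzRingType) (p : set R) :
  is_prime p <-> [/\ is_ideal p, ~ p 1 & forall x y, p (x * y) -> p x \/ p y].
Proof.
split=> [[[p0 p1 pM] pP]|[[p0 pM] p1 pP]].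
  split.
  - split; first exact: set_mem p0.
    by move=> a x y px py; apply: set_mem; apply: pM; apply: mem_set.
  - by move=> h; move/negP: p1; apply; apply: mem_set.
  - by move=> x y pxy; have /orP[/set_mem|/set_mem] := pP _ _ (mem_set pxy); [left|right].
split; first split.
- exact: mem_set.
- by apply/negP => /set_mem.
- by move=> a x y /set_mem px /set_mem py; apply: mem_set; apply: pM.
move=> x y /set_mem/pP[] h; apply/orP; [left|right]; exact: mem_set.
Qed.

Lemma prime_set0 (S : idomainType) : is_prime [set 0 : S].
Proof.
apply/is_primeP; split.
- by split=> // a y z -> ->; rewrite mulr0 addr0.
- by apply/eqP; rewrite oner_eq0.
- by move=> y z /= /eqP; rewrite mulf_eq0 => /orP[]/eqP; [left|right].
Qed.

(** * The local ring at a prime of height at most one of a normal Noetherian domain *)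

Section Localization.
Variables (S : idomainType) (p : set S).
Hypothesis pp : is_prime p.

Let idp : is_ideal p. Proof. by have /is_primeP[] := pp. Qed.

Lemma prime1 : ~ p 1. Proof. by have /is_primeP[] := pp. Qed.

Lemma primeM x y : p (x * y) -> p x \/ p y.
Proof. by have /is_primeP[_ _] := pp; apply. Qed.

Lemma notin_primeM x y : ~ p x -> ~ p y -> ~ p (x * y).
Proof. by move=> px py /primeM[]. Qed.

Lemma notin_prime_neq0 x : ~ p x -> x%:F != 0 :> {fraction S}.
Proof.
by move=> px; rewrite tofrac_eq0; apply/eqP => x0; apply: px; rewrite x0; case: idp.
Qed.

(* The local ring S_p inside the fraction field. *)
Definition loc : set {fraction S} :=
  [set x | exists u v, ~ p v /\ x = u%:F / v%:F].

Lemma loc_frac u : loc u%:F.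
Proof. by exists u, 1; split; [apply: prime1|rewrite tofrac1 divr1]. Qed.

Lemma locD x y : loc x -> loc y -> loc (x + y).
Proof.
move=> [u [v [pv ->]]] [u' [v' [pv' ->]]].
exists (u * v' + u' * v), (v * v'); split; first exact: notin_primeM.
by rewrite addf_div ?notin_prime_neq0 // -!tofracM -tofracD.
Qed.

Lemma locM x y : loc x -> loc y -> loc (x * y).
Proof.
move=> [u [v [pv ->]]] [u' [v' [pv' ->]]].
exists (u * u'), (v * v'); split; first exact: notin_primeM.
by rewrite mulf_div -!tofracM.
Qed.

Lemma loc_mulP x : loc x <-> exists2 w, ~ p w & exists u, w%:F * x = u%:F.
Proof.
split=> [[u [v [pv ->]]]|[w pw [u e]]].
  by exists v => //; exists u; rewrite mulrC divfK // notin_prime_neq0.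
by exists u, w; split => //; rewrite -e mulrC mulKf // notin_prime_neq0.
Qed.

Lemma loc_common_denom (n : nat) (c : 'I_n -> {fraction S}) :
  (forall i, loc (c i)) ->
  exists2 w, ~ p w & forall i, exists u, w%:F * c i = u%:F.
Proof.
elim: n c => [|n IH] c hc; first by exists 1; [apply: prime1|case].
have [w pw hw] := IH (fun i => c (lift ord0 i)) (fun i => hc _).
have /loc_mulP[w' pw' [u' hw']] := hc ord0.
exists (w * w'); first exact: notin_primeM.
move=> i; case: (unliftP ord0 i) => [j ->|->].
  have [u hu] := hw j; exists (w' * u).
  by rewrite !tofracM -hu; ring.
by exists (w * u'); rewrite !tofracM -hw'; ring.
Qed.

Hypotheses (noS : noetherian S) (norS : is_normal S).
Hypothesis ht1 : forall Q : set S, is_prime Q -> Q `<=` p ->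
  (exists2 x, Q x & x != 0) -> p `<=` Q.

(* A maximal ideal of the form (tS_p : y) with y not in tS_p is an associated
   prime of t, hence p itself. *)
Lemma exists_colon t : p t -> t != 0 ->
  exists2 z, ~ loc z & forall g, p g -> loc (z * g%:F).
Proof.
move=> pt t0.
have tF : t%:F != 0 :> {fraction S} by rewrite tofrac_eq0.
pose colon z : set S := [set s | loc (z * s%:F)].
have idc z : is_ideal (colon z).
  split; first by rewrite /colon /= tofrac0 mulr0 -tofrac0; apply: loc_frac.
  move=> a x y; rewrite /colon /= tofracD tofracM mulrDr mulrCA => hx hy.
  by apply: locD => //; apply: locM => //; apply: loc_frac.
pose P : set (set S) := [set I | exists z, [/\ I = colon z, ~ loc z & colon z t]].
have [||I [z [-> nz zt]] Imax] := noetherian_max (P := P) noS.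
- by move=> I [z [-> _ _]].
(* The family is nonempty: 1/t is outside S_p because [t] is in [p], and its product with [t] is
   1. *)
- exists (colon (t%:F)^-1), (t%:F)^-1; split=> //.
  + move=> [u [v [pv e]]]; apply: (pv).
    have -> : v = u * t.
      apply/eqP; rewrite -tofrac_eq tofracM.
      move/(congr1 (fun x => x * t%:F * v%:F)): e.
      by rewrite mulVf // mul1r mulrAC divfK ?notin_prime_neq0 // => ->.
    exact: idealMl.
  + by rewrite /colon /= mulVf // -tofrac1; apply: loc_frac.
(* The colon ideal lies in [p], since an element outside [p] is a unit of S_p, and it contains [t];
   once known to be prime, it contains [p] by [ht1]. *)
exists z => //; apply: ht1; last by exists t.
- apply/is_primeP; split; first exact: idc.
    by rewrite /colon /= tofrac1 mulr1.
  move=> x y; rewrite /colon /= tofracM => zxy.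
  have [zx|zx] := pselect (loc (z * x%:F)); [by left|right].
  (* Passing from [z] to z x enlarges the colon, so maximality brings [y] back into the colon of
     [z]. *)
  apply: (Imax (colon (z * x%:F))).
  + exists (z * x%:F); split => //; rewrite /colon /= mulrAC.
    by apply: locM => //; apply: loc_frac.
  + move=> s; rewrite /colon /= mulrAC => h.
    by apply: locM => //; apply: loc_frac.
  + by rewrite /colon /= -mulrA.
move=> s; rewrite /colon /= => zs; apply: contrapT => ps; apply: nz.
rewrite -(mulfK (notin_prime_neq0 ps) z); apply: locM => //.
by exists 1, s; rewrite tofrac1 div1r.
Qed.

(* If z pS_p were inside pS_p, the Cayley-Hamilton theorem would make z
   integral over S_p. *)
Lemma colon_inv z t : p t -> t != 0 -> ~ loc z ->
  (forall g, p g -> loc (z * g%:F)) -> loc z^-1.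
Proof.
move=> pt t0 nz zp; apply: contrapT => hz; apply: nz.
(* If z g were a unit of S_p, then 1/z = g / (z g) would lie in S_p, against [hz]. So multiplication
   by z maps p S_p to itself. *)
have zpp g : p g -> exists u v, [/\ p u, ~ p v & z * g%:F = u%:F / v%:F].
  move=> pg; have [g0|g0] := eqVneq g 0.
    exists 0, 1; split; [by case: idp|exact: prime1|].
    by rewrite g0 tofrac0 mulr0 mul0r.
  have [u [v [pv e]]] := zp g pg; exists u, v; split=> //.
  apply: contrapT => pu; apply: hz.
  have gF : g%:F != 0 :> {fraction S} by rewrite tofrac_eq0.
  rewrite -(mulfK gF z) invf_div e invf_div.
  by apply: locM; [apply: loc_frac|exists v, u].
have [s sp sJ] := noS idp.
pose n := size s.
have comb x : p x -> exists c : 'I_n -> S, x = \sum_i c i * s`_i.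
  move: x; apply: (sJ [set x | exists c : 'I_n -> S, x = \sum_i c i * s`_i]).
    split; first by exists (fun=> 0); rewrite big1 // => i _; rewrite mul0r.
    move=> a x y [c ->] [c' ->]; exists (fun i => a * c i + c' i).
    by rewrite mulr_sumr -big_split; apply: eq_bigr => i _; rewrite mulrDl mulrA.
  move=> x xs; have ix : (index x s < n)%N by rewrite index_mem.
  exists (fun i => (i == Ordinal ix)%:R).
  rewrite (bigD1 (Ordinal ix)) //= eqxx mul1r nth_index // big1 ?addr0 // => i.
  by move=> /negbTE ->; rewrite mul0r.
have rows (i : 'I_n) : exists (c : 'I_n -> S) v, ~ p v /\
    z * (s`_i)%:F = (\sum_j c j * s`_j)%:F / v%:F.
  have [u [v [pu pv e]]] := zpp s`_i (sp _ (mem_nth 0 (ltn_ord i))).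
  by have [c hc] := comb u pu; exists c, v; split=> //; rewrite e hc.
have [c /choice[v hv]] := choice rows.
have [w pw hw] := loc_common_denom (c := fun i => (v i)%:F^-1)
  (fun i => ex_intro _ 1 (ex_intro _ (v i) (conj (hv i).1 (esym (mul1r _))))).
have [u hu] := choice hw.
apply/loc_mulP; exists w => //.
(* Clearing denominators makes w z, rather than z, an eigenvalue of a matrix over [S], with the
   generators of [p] as eigenvector; normality of [S] itself then applies. *)
suff /norS[x ->] : integralOver (@FracField.tofrac S) (w%:F * z) by exists x.
pose M : 'M[S]_n := \matrix_(j, i) (u i * c i j).
exists (char_poly M); first exact: char_poly_monic.
rewrite map_char_poly -eigenvalue_root_char; apply/eigenvalueP.
exists (\row_i (s`_i)%:F).
  apply/rowP => i; rewrite !mxE -mulrA (hv i).2 mulrCA hu mulrC rmorph_sum.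
  rewrite mulr_sumr; apply: eq_bigr => j _; rewrite !mxE.
  by rewrite /= !tofracM; ring.
apply: contra_neq t0 => /rowP s0.
suff s0' : forall x, x \in s -> x = 0.
  apply: (sJ [set 0]) => //.
  by split=> // a ? ? -> ->; rewrite mulr0 addr0.
move=> x xs; have ix : (index x s < n)%N by rewrite index_mem.
have := s0 (Ordinal ix); rewrite !mxE /= nth_index // => /eqP.
by rewrite tofrac_eq0 => /eqP.
Qed.

(** For nonzero p, 1/z is a uniformizer: an element of S_p is a unit or stays in S_p after
    multiplication by z ([zm]). Suppose that neither x nor 1/x is in S_p. If c is nonzero and both c
    and c/x are in S_p, then neither is a unit, so z c has the same properties. At a c for which c
    S_p has maximal trace on S, this forces z into S_p. *)
Lemma loc_valuation (a b : S) : a != 0 -> b != 0 ->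
  loc (a%:F / b%:F) \/ loc (b%:F / a%:F).
Proof.
move=> a0 b0; rewrite -[X in _ \/ loc X]invf_div; set x := _ / _.
have [[t pt t0]|hp0] := pselect (exists2 t, p t & t != 0); last first.
  left; exists a, b; split=> // pb.
  by apply: hp0; exists b.
have [z nz zp] := exists_colon pt t0.
have zV := colon_inv pt t0 nz zp.
have z0 : z != 0.
  by apply/eqP => e; apply: nz; rewrite e -tofrac0; apply: loc_frac.
have zm y : loc y -> loc (z * y) \/ loc y^-1.
  move=> [u [v [pv ->]]]; have [pu|pu] := pselect (p u).
    left; rewrite mulrA; apply: locM; first exact: zp.
    by exists 1, v; rewrite tofrac1 div1r.
  by right; rewrite invf_div; exists v, u.
apply: contrapT => /not_orP[nx nx'].
have x0 : x != 0.
  by apply/eqP => e; apply: nx; rewrite e -tofrac0; apply: loc_frac.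
pose I c : set S := [set s | loc (s%:F / c)].
pose P : set (set S) :=
  [set J | exists c, [/\ J = I c, c != 0, loc c & loc (c / x)]].
have idI c : is_ideal (I c).
  split; first by rewrite /I /= tofrac0 mul0r -tofrac0; apply: loc_frac.
  move=> r y y'; rewrite /I /= tofracD tofracM mulrDl -mulrA => hy hy'.
  by apply: locD => //; apply: locM => //; apply: loc_frac.
have [||J [c [-> c0 lc lcx]] Jmax] := noetherian_max (P := P) noS.
- by move=> J [c [-> _ _ _]].
- exists (I a%:F), a%:F; split=> //; [by rewrite tofrac_eq0|exact: loc_frac|].
  rewrite /x invf_div mulrC divfK ?tofrac_eq0 //; exact: loc_frac.
have lc' : loc (z * c).
  have [//|hc] := zm _ lc; case: nx'; rewrite -(mulKf c0 x^-1).
  exact: locM hc lcx.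
have lcx' : loc (z * c / x).
  rewrite -mulrA; have [//|hc] := zm _ lcx; case: nx.
  have := locM lc hc; by rewrite invf_div mulrC divfK.
have zc0 : z * c != 0 by rewrite mulf_neq0.
have sub : I c `<=` I (z * c).
  by move=> s; rewrite /I /= invfM mulrCA => hs; apply: locM.
have [u [v [pv e]]] := lc'.
have v0 := notin_prime_neq0 pv.
have : I c u.
  apply: (Jmax (I (z * c))) sub _ _; first by exists (z * c).
  rewrite /I /= e invf_div mulrC divfK; first exact: loc_frac.
  by apply: contra_neq zc0 => u0; rewrite e u0 mul0r.
rewrite /I /= => luc; apply: nz.
have -> : z = u%:F / c * v%:F^-1 by rewrite mulrAC -e mulfK.
by apply: locM => //; exists 1, v; rewrite tofrac1 div1r.
Qed.

End Localization.

(** * Homogeneous components *)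

Section HomogeneousComponents.
Variables (K : fieldType) (S : standardGradedDomain K).
Implicit Types (x y : S) (h : nat -> S).

(** A family over all of [nat], zero from some degree on, so that decompositions of different
    lengths can be compared. *)
Definition is_decomp x h : Prop :=
  (forall k, sgd_part k (h k)) /\
  exists2 N, (forall k, (N <= k)%N -> h k = 0) & x = \sum_(k < N) h k.

Lemma is_decomp_ex x : exists h, is_decomp x h.
Proof.
have [N [y [hy ->]]] := sgd_decomp x.
pose h k := if insub k is Some i then y i else 0.
have hk (i : 'I_N) : h i = y i.
  by rewrite /h insubT // => hi; congr y; apply: val_inj.
exists h; split.
  move=> k; rewrite /h; case: insubP => [i _ <-|_]; first exact: hy.
  exact: sgd_part_zero.
exists N; last by apply: eq_bigr => i _; rewrite hk.
by move=> k Nk; rewrite /h insubN // -leqNgt.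
Qed.

Lemma is_decompB x y h h' : is_decomp x h -> is_decomp y h' ->
  is_decomp (x - y) (fun k => h k - h' k).
Proof.
move=> [hh [N hN ->]] [hh' [N' hN' ->]]; split.
  by move=> k; apply: sgd_partB.
have ext (g : nat -> S) M M' : (M <= M')%N ->
    (forall k, (M <= k)%N -> g k = 0) -> \sum_(k < M) g k = \sum_(k < M') g k.
  move=> MM' hM; rewrite -!(big_mkord xpredT g) (big_cat_nat (leq0n M) MM') //=.
  by rewrite [X in _ = _ + X]big_nat [X in _ = _ + X]big1 ?addr0 // => k /andP[/hM].
exists (maxn N N').
  by move=> k; rewrite geq_max => /andP[/hN -> /hN' ->]; rewrite subrr.
by rewrite sumrB -(ext h N) ?leq_maxl // -(ext h' N') ?leq_maxr.
Qed.

Lemma is_decomp_uniq x h h' : is_decomp x h -> is_decomp x h' -> h =1 h'.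
Proof.
move=> hx hx' k; have [hh [N hN]] := is_decompB hx hx'; rewrite subrr => s0.
apply/eqP; rewrite -subr_eq0; apply/eqP.
have [/hN//|kN] := leqP N k.
by have /= := sgd_direct (fun i : 'I_N => hh i) (esym s0) (Ordinal kN).
Qed.

Definition hcomp x (d : int) : S :=
  if d is Posz k then sval (cid (is_decomp_ex x)) k else 0.

Arguments hcomp : simpl never.

Lemma hcompP x : is_decomp x (fun k => hcomp x k).
Proof. exact: svalP (cid (is_decomp_ex x)). Qed.

Lemma hpart_hcomp x d : hpart d (hcomp x d).
Proof. by case: d => [k|k] //; apply: (hcompP x).1. Qed.

Lemma hcomp_eq x h k : is_decomp x h -> hcomp x (Posz k) = h k.
Proof. by move=> hx; apply: (is_decomp_uniq (hcompP x) hx). Qed.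

Lemma hcompB x y d : hcomp (x - y) d = hcomp x d - hcomp y d.
Proof.
case: d => [k|k]; last by rewrite /hcomp subr0.
by rewrite (hcomp_eq _ (is_decompB (hcompP x) (hcompP y))).
Qed.

Lemma hcomp0 d : hcomp 0 d = 0.
Proof. by have := hcompB 0 0 d; rewrite !subrr. Qed.

Lemma hcompD x y d : hcomp (x + y) d = hcomp x d + hcomp y d.
Proof. by have := hcompB (x + y) y d; rewrite addrK => ->; rewrite subrK. Qed.

Lemma hcomp_sum (I : Type) (r : seq I) (F : I -> S) d :
  hcomp (\sum_(i <- r) F i) d = \sum_(i <- r) hcomp (F i) d.
Proof.
elim: r => [|i r IH]; first by rewrite !big_nil hcomp0.
by rewrite !big_cons hcompD IH.
Qed.

Lemma hcomp_mul_hpart d e x y : hpart d x -> hcomp (x * y) (d + e) = x * hcomp y e.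
Proof.
case: d => [k|k] hx; last first.
  by move: hx => /= ->; rewrite !mul0r hcomp0.
have dec : is_decomp (x * y)
    (fun l => if (l < k)%N then 0 else x * hcomp y (Posz (l - k))).
  have [hh [N hN {1}->]] := hcompP y; split.
    move=> l; case: ltnP => kl; first exact: sgd_part_zero.
    by rewrite -[X in sgd_part X](subnKC kl); apply: sgd_partM.
  exists (k + N)%N.
    move=> l kNl; have kl : (k <= l)%N := leq_trans (leq_addr _ _) kNl.
    by rewrite ltnNge kl /= hN ?mulr0 // leq_subRL.
  rewrite big_split_ord /= [X in _ = X + _]big1 ?add0r => [|i _]; last first.
    by rewrite /= ltn_ord.
  rewrite mulr_sumr; apply: eq_bigr => i _.
  by rewrite ltnNge leq_addr /= addKn.
case: e => [l|l].
  by rewrite (hcomp_eq _ dec) ltnNge leq_addr /= addKn.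
rewrite [hcomp y _]/hcomp mulr0; case E : (_ + _)%R => [i|//].
rewrite (hcomp_eq _ dec) ifT //.
by rewrite -ltz_nat -E NegzE gtrBl.
Qed.

Lemma hcomp_id d x : hpart d x -> hcomp x d = x.
Proof.
move=> hx; have := hcomp_mul_hpart 0 1 hx; rewrite mulr1 addr0 => ->.
suff -> : hcomp 1 0 = 1 by rewrite mulr1.
have dec : is_decomp 1 (fun l => if l is 0%N then 1 else 0).
  split; first by case=> [|l]; [apply: (hpart1 S)|apply: sgd_part_zero].
  by exists 1%N; [case|rewrite big_ord1].
by rewrite (hcomp_eq _ dec).
Qed.

Lemma hcomp_neq d e x : hpart d x -> d != e -> hcomp x e = 0.
Proof.
move=> hx de; have := hcomp_mul_hpart (e - d) 1 hx.
rewrite mulr1 addrC subrK => ->.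
suff -> : hcomp 1 (e - d) = 0 by rewrite mulr0.
have dec : is_decomp 1 (fun l => if l is 0%N then 1 else 0).
  split; first by case=> [|l]; [apply: (hpart1 S)|apply: sgd_part_zero].
  by exists 1%N; [case|rewrite big_ord1].
move: de; rewrite eq_sym -subr_eq0; case: (e - d) => [[|k]|k] // _.
by rewrite (hcomp_eq _ dec).
Qed.

(** Degrees are nonnegative, so no product involving a higher component reaches degree 0. Hence the
    irrelevant ideal, where this component vanishes, is prime. *)
Lemma hcomp0M x y : hcomp (x * y) 0 = hcomp x 0 * hcomp y 0.
Proof.
have [hh [N hN ex]] := hcompP x.
rewrite {1}ex mulr_suml hcomp_sum.
case: N hN ex => [|N] hN ex; first by rewrite big_ord0 hN // mul0r.
rewrite big_ord_recl big1 ?addr0 => [|i _].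
  by rewrite -[X in hcomp _ X]addr0 (hcomp_mul_hpart _ _ (hpart_hcomp _ _)).
have -> : 0 = Posz (lift ord0 i) + - Posz (lift ord0 i) by rewrite subrr.
by rewrite (hcomp_mul_hpart _ _ (hpart_hcomp _ _)) [hcomp y _](_ : _ = 0) ?mulr0.
Qed.

End HomogeneousComponents.

(** * Points of Proj S *)

Section ProjPoints.
Variables (K : fieldType) (S : standardGradedDomain K) (p : proj_space S).

Lemma proj_is_ideal : is_ideal (proj_ideal p).
Proof. by have /is_primeP[] := proj_prime p. Qed.

Lemma proj_ideal_hcomp x d : proj_ideal p x -> proj_ideal p (hcomp x d).
Proof.
case: d => [k|k] px; last exact: proj_ideal0.
have [hh [N hN ex]] := hcompP x.
have [/hN ->|kN] := leqP N k; first exact: proj_ideal0.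
have := proj_homogeneous (p := p) (fun i : 'I_N => hh i).
by rewrite -ex => /(_ px (Ordinal kN)).
Qed.

Lemma notin_proj_ideal_hcomp x : ~ proj_ideal p x ->
  exists d, ~ proj_ideal p (hcomp x d).
Proof.
move=> px; apply: contrapT => h; apply: px.
have [hh [N hN ->]] := hcompP x.
apply: ideal_sum => [|i _]; first exact: proj_is_ideal.
by apply: contrapT => hi; apply: h; exists (Posz i).
Qed.

Lemma proj_ideal_part0 x : proj_ideal p x -> hpart 0 x -> x = 0.
Proof.
rewrite /= sgd_part0 => px [c _ cx]; move: px; rewrite -cx.
have [->|c0] := eqVneq c 0; first by rewrite rmorph0.
move=> pc; have [] := proj_ideal1 (p := p).
by rewrite -(rmorph1 (sgd_struct S)) -(mulVf c0) rmorphM; apply: proj_idealMl.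
Qed.

(** Otherwise [p] contains all the generators, so S = K + p, and every homogeneous element of
    positive degree lies in [p], against [proj_relevant]. *)
Lemma exists_deg1_notin : exists2 l : S, hpart 1 l & ~ proj_ideal p l.
Proof.
have [gens [gens1 gen]] := sgd_gen S.
have idp := proj_is_ideal.
apply: contrapT => h.
have hg g : g \in gens -> proj_ideal p g.
  by move=> /gens1 g1; apply: contrapT => pg; apply: h; exists g.
have all x : exists c : K, proj_ideal p (x - sgd_struct S c).
  move: x; apply: gen.
  - by move=> c; exists c; rewrite subrr; apply: proj_ideal0.
  - by move=> x /hg px; exists 0; rewrite rmorph0 subr0.
  - move=> x y [c xc] [c' yc]; exists (c + c').
    by rewrite rmorphD opprD addrACA; apply: idealD.
  - move=> x y [c xc] [c' yc]; exists (c * c').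
    set u := sgd_struct S c in xc *; set v := sgd_struct S c' in yc *.
    have -> : x * y - sgd_struct S (c * c') = y * (x - u) + u * (y - v).
      by rewrite rmorphM -/u -/v; ring.
    by apply: idealD => //; apply: idealMl.
have [d [x [d0 hx px]]] := proj_relevant p; apply: px.
have [c /(proj_ideal_hcomp d)] := all x.
rewrite hcompB (hcomp_id (d := d)) // (hcomp_neq (d := 0) (e := d)) ?subr0 //.
  by rewrite /= sgd_part0; exists c.
by rewrite eqz_nat eq_sym -lt0n.
Qed.

(* Together with [0] and the irrelevant ideal, a prime strictly between [0] and
   [p] would give a chain of length 3. *)
Lemma proj_height1 : krull_dim S 2 ->
  forall Q : set S, is_prime Q -> Q `<=` proj_ideal p ->
  (exists2 x, Q x & x != 0) -> proj_ideal p `<=` Q.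
Proof.
move=> [_ nochain] Q primeQ Qp [x Qx x0]; apply: contrapT => pQ.
apply: nochain.
pose irr : set S := [set x | hcomp x 0 = 0].
have irrE y : irr y = (hcomp y 0 = 0) by [].
exists (fun k => match k with
  0%N => [set 0] | 1%N => Q | 2%N => proj_ideal p | _ => irr end).
split=> [[|[|[|k]]] _|[|[|[|k]]] //= _] //.
- exact: prime_set0.
- exact: proj_prime.
- apply/is_primeP; split.
  + split; first exact: hcomp0.
    by move=> a y z; rewrite !irrE hcompD hcomp0M => -> ->; rewrite mulr0 addr0.
  + by rewrite !irrE (hcomp_id (hpart1 S)); apply/eqP; rewrite oner_eq0.
  + move=> y z; rewrite !irrE hcomp0M => /eqP.
    by rewrite mulf_eq0 => /orP[]/eqP; [left|right].
- split; first by have /is_primeP[[Q0 _] _ _] := primeQ => y ->.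
  by move=> h; have := h _ Qx => /= xz; rewrite xz eqxx in x0.
- split=> [y py|].
    rewrite !irrE; apply: proj_ideal_part0; last exact: hpart_hcomp.
    exact: proj_ideal_hcomp.
  have [d [y [d0 hy py]]] := proj_relevant p => h; apply: py; apply: h.
  by rewrite !irrE (hcomp_neq (d := d)) // eqz_nat -lt0n.
Qed.

End ProjPoints.

(** * Graded fractions and the kernel of A over L *)

Section GradedFractions.
Variables (K : fieldType) (S : standardGradedDomain K).
Local Notation L := {fraction S}.

(* S(d)_(p) for a homogeneous prime [p]; for [p = 0] these are all the
   homogeneous fractions of degree [d]. *)
Definition hloc (p : set S) (d : int) : set L :=
  [set x | exists k a f, [/\ hpart (k + d) a, hpart k f, ~ p f & x = a%:F / f%:F]].

Lemma hlocS (p q : set S) d : q `<=` p -> hloc p d `<=` hloc q d.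
Proof.
move=> qp x [k [a [f [ha hf pf ->]]]]; exists k, a, f; split=> //.
by move=> /qp.
Qed.

Section Closure.
Variables (p : set S) (pp : is_prime p).

Lemma hloc0 d : hloc p d 0.
Proof.
exists 0, 0, 1; split; [exact: hpart0|exact: hpart1|exact: prime1|].
by rewrite tofrac0 mul0r.
Qed.

Lemma hloc1 : hloc p 0 1.
Proof.
exists 0, 1, 1; split; [exact: hpart1|exact: hpart1|exact: prime1|].
by rewrite divff // tofrac1 oner_eq0.
Qed.

Lemma hlocD d x y : hloc p d x -> hloc p d y -> hloc p d (x + y).
Proof.
move=> [k [a [f [ha hf pf ->]]]] [k' [a' [f' [ha' hf' pf' ->]]]].
exists (k + k'), (a * f' + a' * f), (f * f'); split.
- apply: hpartD.
    by have := hpartM ha hf'; congr hpart; ring.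
  by have := hpartM ha' hf; congr hpart; ring.
- exact: hpartM.
- exact: notin_primeM.
- rewrite addf_div ?(notin_prime_neq0 pp) //.
  by rewrite tofracD !tofracM.
Qed.

Lemma hlocN d x : hloc p d x -> hloc p d (- x).
Proof.
move=> [k [a [f [ha hf pf ->]]]]; exists k, (- a), f; split=> //.
  exact: hpartN.
by rewrite tofracN mulNr.
Qed.

Lemma hlocM d e x y : hloc p d x -> hloc p e y -> hloc p (d + e) (x * y).
Proof.
move=> [k [a [f [ha hf pf ->]]]] [k' [a' [f' [ha' hf' pf' ->]]]].
exists (k + k'), (a * a'), (f * f'); split.
- by have := hpartM ha ha'; congr hpart; ring.
- exact: hpartM.
- exact: notin_primeM.
- by rewrite !tofracM mulf_div.
Qed.

Lemma hloc_sum d (I : Type) (r : seq I) (P : pred I) (F : I -> L) :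
  (forall i, P i -> hloc p d (F i)) -> hloc p d (\sum_(i <- r | P i) F i).
Proof.
by move=> h; elim/big_ind: _ => //; [exact: hloc0|move=> x y; exact: hlocD].
Qed.

End Closure.

Lemma hloc_sub0 p d : is_prime p -> hloc p d `<=` hloc [set 0] d.
Proof. by move=> /is_primeP[[p0 _] _ _]; apply: hlocS => x ->. Qed.

Lemma hlocV d x : hloc [set 0] d x -> hloc [set 0] (- d) x^-1.
Proof.
move=> [k [a [f [ha hf pf ->]]]]; rewrite invf_div.
have [->|a0] := eqVneq a 0; last first.
  exists (k + d), f, a; split=> //; first by rewrite addrK.
  exact/eqP.
by rewrite tofrac0 invr0 mulr0; exact: hloc0 (@prime_set0 _) _.
Qed.

Lemma hloc_hpart p d x : is_prime p -> hpart d x -> hloc p d x%:F.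
Proof.
move=> pp hx; exists 0, x, 1; split; rewrite ?add0r //; first exact: hpart1.
  exact: prime1.
by rewrite tofrac1 divr1.
Qed.

(** The denominator outside [p] need not be homogeneous. From a/f = u/v follows a v = f u; for a
    degree l with v_l outside [p], the components of degree k + d + l give a v_l = f u_{l+d}. *)
Lemma hloc_loc (p : proj_space S) d x :
  hloc [set 0] d x -> loc (proj_ideal p) x -> hloc (proj_ideal p) d x.
Proof.
move=> [k [a [f [ha hf /eqP f0 ->]]]] [u [v [pv e]]].
have [l pl] := notin_proj_ideal_hcomp pv.
exists l, (hcomp u (l + d)), (hcomp v l); split=> //; try exact: hpart_hcomp.
have v0 : v%:F != 0 :> L := notin_prime_neq0 (proj_prime p) pv.
have l0 : (hcomp v l)%:F != 0 :> L := notin_prime_neq0 (proj_prime p) pl.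
have fF : f%:F != 0 :> L by rewrite tofrac_eq0.
have {}e : a * v = f * u.
  apply/eqP; rewrite -tofrac_eq !tofracM; apply/eqP.
  by rewrite -[a%:F](divfK fF) e mulrAC mulrC divfK.
have {}e : a * hcomp v l = f * hcomp u (l + d).
  rewrite -(hcomp_mul_hpart l v ha) -(hcomp_mul_hpart (l + d) u hf) e.
  by congr hcomp; ring.
apply: (mulIf l0); rewrite divfK // mulrAC -tofracM e tofracM mulrAC mulfV //.
by rewrite mul1r.
Qed.

Lemma hloc_valuation (p : proj_space S) d x :
  is_normal S -> krull_dim S 2 -> hloc [set 0] d x ->
  hloc (proj_ideal p) d x \/ hloc (proj_ideal p) (- d) x^-1.
Proof.
move=> nS dimS hx.
have noS : noetherian S.
  by have [gens [_ gen]] := sgd_gen S; apply: noetherian_fg_algebra gen.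
have [x0|x0] := eqVneq x 0; first by left; rewrite x0; apply: hloc0 (proj_prime p) _.
have [k [a [f [ha hf /eqP f0 xE]]]] := hx.
have a0 : a != 0 by apply: contra_neq x0 => a0; rewrite xE a0 tofrac0 mul0r.
have := loc_valuation (proj_prime p) noS nS (proj_height1 dimS) a0 f0.
by case; [left; apply: hloc_loc => //|right; apply: hloc_loc; first exact: hlocV];
   rewrite xE ?invf_div.
Qed.

End GradedFractions.

(** * Gaussian elimination over a graded valuation ring *)

Section KernelGraph.
Variables (K : fieldType) (S : standardGradedDomain K) (p : proj_space S).
Hypotheses (nS : is_normal S) (dimS : krull_dim S 2).
Variables (n : nat) (e : 'I_n -> int).
Local Notation L := {fraction S}.
Local Notation O := (hloc (proj_ideal p)).
Local Notation Frac := (hloc [set 0 : S]).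
Let pp := proj_prime p.

(** An entry of least valuation, found by comparing each entry with the best one so far. The shift
    [D], common to the row, cancels in quotients. *)
Lemma exists_pivot (D : int) (psi : 'I_n -> L) (B : {set 'I_n}) :
  (forall i, i \in B -> Frac (e i + D) (psi i)) ->
  (forall i, i \in B -> psi i = 0) \/
  exists k0, [/\ k0 \in B, psi k0 != 0 &
     forall i, i \in B -> O (e i - e k0) (psi i / psi k0)].
Proof.
move=> hpsi.
suff: (forall i, i \in enum B -> psi i = 0) \/
    exists k0, [/\ k0 \in enum B, psi k0 != 0 &
     forall i, i \in enum B -> O (e i - e k0) (psi i / psi k0)].
  case=> [h|[k0 [kB k0n h]]]; [left => i iB; apply: h; rewrite mem_enum //|right].
  by exists k0; split=> [|//|i iB]; [rewrite mem_enum in kB|apply: h; rewrite mem_enum].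
have {}hpsi i : i \in enum B -> Frac (e i + D) (psi i) by rewrite mem_enum; exact: hpsi.
elim: (enum B) hpsi => [|x s IH] hpsi; first by left.
have hs i : i \in s -> Frac (e i + D) (psi i).
  by move=> si; apply: hpsi; rewrite inE si orbT.
have hx : Frac (e x + D) (psi x) by apply: hpsi; rewrite mem_head.
have Oxx i : psi i != 0 -> O (e i - e i) (psi i / psi i).
  by move=> i0; rewrite divff // subrr; apply: hloc1.
have [x0|x0] := eqVneq (psi x) 0; case: (IH hs) => [s0|[k [ks k0 hk]]].
- by left=> i; rewrite inE => /orP[/eqP ->|/s0].
- right; exists k; split=> [||i]; rewrite ?inE ?ks ?orbT //.
  by move=> /orP[/eqP ->|/hk //]; rewrite x0 mul0r; apply: hloc0.
- right; exists x; split=> [||i]; rewrite ?inE ?eqxx //.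
  by move=> /orP[/eqP ->|/s0 ->]; [apply: Oxx|rewrite mul0r; apply: hloc0].
have hxk : Frac (e x - e k) (psi x / psi k).
  have -> : e x - e k = (e x + D) + - (e k + D) by ring.
  by apply: hlocM; [exact: prime_set0|exact: hx|apply: hlocV; exact: hs].
right; case: (hloc_valuation p nS dimS hxk) => [xk|kx].
  by exists k; split=> [||i]; rewrite ?inE ?ks ?orbT // => /orP[/eqP ->|/hk].
exists x; split=> [||i]; rewrite ?inE ?eqxx // => /orP[/eqP ->|/hk ik].
  exact: Oxx.
have -> : e i - e x = (e i - e k) + - (e x - e k) by ring.
have -> : psi i / psi x = (psi i / psi k) * (psi x / psi k)^-1.
  by rewrite invf_div mulrA divfK.
exact: hlocM.
Qed.

(* The kernel is the graph of a map from L^B with coefficients in O_p: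
   Gaussian elimination with pivots of least valuation. *)
Lemma kernel_graph (m : nat) (phi : 'I_m -> 'I_n -> L) (d : 'I_m -> int) :
  (forall j i, Frac (e i + d j) (phi j i)) ->
  exists (B : {set 'I_n}) (C : 'I_n -> 'I_n -> L),
  [/\ forall k i, O (e i - e k) (C k i),
      forall k i, k \in B -> i \in B -> C k i = (k == i)%:R &
      forall v : 'I_n -> L, (forall j, \sum_i phi j i * v i = 0) <->
        (forall k, v k = \sum_(i in B) C k i * v i)].
Proof.
move=> hphi.
suff /(_ (enum 'I_m))[B [C [hC CB hv]]] : forall s : seq 'I_m,
  exists (B : {set 'I_n}) (C : 'I_n -> 'I_n -> L),
  [/\ forall k i, O (e i - e k) (C k i),
      forall k i, k \in B -> i \in B -> C k i = (k == i)%:R &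
      forall v : 'I_n -> L, (forall j, j \in s -> \sum_i phi j i * v i = 0) <->
        (forall k, v k = \sum_(i in B) C k i * v i)].
  exists B, C; split=> // v; rewrite -hv; split=> h j; last by apply: h; rewrite mem_enum.
  by move=> _; apply: h.
elim=> [|j s [B [C [hC CB hv]]]].
  exists [set: 'I_n]%SET, (fun k i => (k == i)%:R); split=> //.
    move=> k i; have [->|_] := eqVneq k i; last exact: hloc0.
    by rewrite subrr; apply: hloc1.
  move=> v; split=> // _ k; rewrite (bigD1 k) ?in_setT // big1 /= ?addr0 ?eqxx ?mul1r //.
  by move=> i /andP[_ ik]; rewrite eq_sym (negbTE ik) mul0r.
(* Row j of the system, rewritten in the coordinates that are still free. *)
pose psi i := \sum_k phi j k * C k i.
have hpsi i : i \in B -> Frac (e i + d j) (psi i).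
  move=> _; apply: hloc_sum => [|k _]; first exact: prime_set0.
  have -> : e i + d j = (e k + d j) + (e i - e k) by ring.
  by apply: hlocM; [exact: prime_set0|exact: hphi|exact: (hloc_sub0 pp)].
have row (v : 'I_n -> L) : (forall k, v k = \sum_(i in B) C k i * v i) ->
    \sum_i phi j i * v i = \sum_(i in B) psi i * v i.
  move=> vE; under eq_bigr => i _ do rewrite vE mulr_sumr.
  rewrite exchange_big /=; apply: eq_bigr => i _; rewrite mulr_suml.
  by apply: eq_bigr => k _; rewrite mulrA.
have hcons v : (forall j', j' \in j :: s -> \sum_i phi j' i * v i = 0) <->
    (forall k, v k = \sum_(i in B) C k i * v i) /\ \sum_(i in B) psi i * v i = 0.
  split=> [h|[vE h0] j'].
    have vE : forall k, v k = \sum_(i in B) C k i * v i.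
      by apply/hv => j' js; apply: h; rewrite inE js orbT.
    by split=> //; rewrite -row // h ?mem_head.
  by rewrite inE => /orP[/eqP ->|]; [rewrite row|exact: (hv v).2 vE j'].
case: (exists_pivot hpsi) => [psi0|[k0 [k0B k00 hk0]]].
  exists B, C; split=> // v; split=> [/hcons[]//|vE]; apply/hcons; split=> //.
  by rewrite big1 // => i /psi0 ->; rewrite mul0r.
pose t i := psi i / psi k0.
have tE i : psi i = psi k0 * t i by rewrite /t mulrC divfK.
have C0 k : k \in (B :\ k0)%SET -> C k k0 = 0.
  by rewrite !inE => /andP[kk kB]; rewrite CB // (negbTE kk).
(* Solving row j for the pivot gives v_k0 = - sum of t_i v_i, which is substituted. Outside [B] the
   regularity of t_i is not known, so the coefficient is set to 0 there to keep it in O_p. *)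
exists (B :\ k0)%SET, (fun k i => if i \in B then C k i - C k k0 * t i else 0); split.
- move=> k i; case: ifPn => iB; last exact: hloc0.
  apply: hlocD => //; apply: hlocN.
  have -> : e i - e k = (e k0 - e k) + (e i - e k0) by ring.
  by apply: hlocM => //; apply: hk0.
- move=> k i kB iB; rewrite C0 // mul0r subr0.
  by move: kB iB; rewrite !inE => /andP[_ kB] /andP[_ iB]; rewrite iB CB.
move=> v; apply: (iff_trans (hcons v)).
have splitB (F : 'I_n -> L) : \sum_(i in B) F i = F k0 + \sum_(i in B :\ k0) F i.
  by rewrite (bigD1 k0) //=; congr (_ + _); apply: eq_bigl => i; rewrite !inE andbC.
have rhs k : \sum_(i in B :\ k0) (if i \in B then C k i - C k k0 * t i else 0) * v i =
    \sum_(i in B :\ k0) C k i * v i - C k k0 * \sum_(i in B :\ k0) t i * v i.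
  rewrite mulr_sumr -sumrB; apply: eq_bigr => i; rewrite !inE => /andP[_ ->].
  by rewrite mulrBl mulrA.
have psiE : \sum_(i in B) psi i * v i = psi k0 * (v k0 + \sum_(i in B :\ k0) t i * v i).
  rewrite splitB mulrDr mulr_sumr; congr (_ + _).
  by apply: eq_bigr => i _; rewrite tE mulrA.
split=> [[vE /eqP]|vE].
  rewrite psiE mulf_eq0 (negbTE k00) /= addr_eq0 => /eqP vk0 k.
  by rewrite rhs [LHS]vE splitB vk0 mulrN addrC.
have vk0 : v k0 = - \sum_(i in B :\ k0) t i * v i.
  rewrite [LHS]vE rhs CB // eqxx mul1r big1 ?add0r // => i.
  by rewrite !inE => /andP[ik iB]; rewrite CB // eq_sym (negbTE ik) mul0r.
split=> [k|]; last by rewrite psiE vk0 addNr mulr0.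
by rewrite splitB vk0 [LHS]vE rhs mulrN addrC.
Qed.

End KernelGraph.

(** * Germs and sheafification *)

Section Germs.
Variables (X : topologicalType) (P : presheaf X).
Implicit Types s t u : local_section P.

Definition opensI (U V : opens X) : opens X :=
  Opens (openI (ocar_open U) (ocar_open V)).

Lemma same_germ_sym x s t : same_germ x s t -> same_germ x t s.
Proof.
by move=> [W [hs [ht [Wx st]]]]; exists W, ht, hs; split=> //; apply: peqv_sym.
Qed.

Lemma same_germ_trans x s t u :
  same_germ x s t -> same_germ x t u -> same_germ x s u.
Proof.
move=> [W [hs [ht [Wx st]]]] [W' [ht' [hu [Wx' tu]]]].
have i1 : ocar (opensI W W') `<=` ocar W by move=> y [].
have i2 : ocar (opensI W W') `<=` ocar W' by move=> y [].
exists (opensI W W'), (subset_trans i1 hs), (subset_trans i2 hu); split=> //.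
apply: peqv_trans (peqv_sym (pres_comp hs i1 (subset_trans i1 hs) _)) _.
apply: peqv_trans (peqv_res i1 st) _.
apply: peqv_trans (pres_comp ht i1 (subset_trans i1 ht) _) _.
apply: peqv_trans (pres_comp hu i2 (subset_trans i2 hu) _).
apply: peqv_trans (peqv_res i2 tu).
apply: peqv_sym; exact: pres_comp.
Qed.

Lemma same_germ_res x (U V : opens X) (h : ocar V `<=` ocar U) (a : psec P U) :
  ocar V x -> same_germ x (existT _ U a) (existT _ V (pres P h a)).
Proof.
move=> Vx; exists V, h, (@subset_refl _ (ocar V)); split=> //=.
by apply: peqv_sym; apply: pres_id.
Qed.

Lemma same_germ_refl x s : ocar (tag s) x -> same_germ x s s.
Proof.
move=> sx; exists (tag s), (@subset_refl _ _), (@subset_refl _ _); split=> //.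
exact: peqv_refl.
Qed.

Lemma germ_eq x s t : same_germ x s t -> germ x s = germ x t.
Proof.
move=> st; rewrite eqEsubset; split=> u.
  by apply: same_germ_trans; apply: same_germ_sym.
exact: same_germ_trans.
Qed.

Variables (W : zmodType) (f : forall U, psec P U -> X -> W).
Hypothesis f_eqv : forall U (s t : psec P U), peqv P s t -> f s = f t.
Hypothesis f_res : forall (U V : opens X) (h : ocar V `<=` ocar U) (s : psec P U) x,
  ocar V x -> f (pres P h s) x = f s x.

Lemma same_germ_value x s t :
  same_germ x s t -> f (tagged s) x = f (tagged t) x.
Proof.
move=> [V [hs [ht [Vx st]]]].
by rewrite -(f_res hs) // -(f_res ht) // (f_eqv st).
Qed.

Lemma sheaf_lift_germ (a : X -> set (local_section P)) x t :
  ocar (tag t) x -> a x = germ x t -> sheaf_lift P f a x = f (tagged t) x.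
Proof.
move=> tx ax; rewrite /sheaf_lift; case: pselect => [h|h]; last first.
  by case: h; exists t; rewrite ax; apply: same_germ_refl.
case: cid => u /=; rewrite ax => tu.
exact/esym/same_germ_value.
Qed.

Hypothesis f_inj : forall U (s t : psec P U) x, ocar U x ->
  (forall y, ocar U y -> f s y = f t y) ->
  same_germ x (existT _ U s) (existT _ U t).

Lemma same_germ_of_values s t (V : set X) x : open V -> V x ->
  ocar (tag s) x -> ocar (tag t) x ->
  (forall y, V y -> ocar (tag s) y -> ocar (tag t) y ->
     f (tagged s) y = f (tagged t) y) -> same_germ x s t.
Proof.
case: s t => [U a] [U' b] /= oV Vx Ux Ux' h.
pose I := opensI (opensI U U') (Opens oV).
have i1 : ocar I `<=` ocar U by move=> y [[]].
have i2 : ocar I `<=` ocar U' by move=> y [[]].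
apply: same_germ_trans (same_germ_res i1 a _) _ => //.
apply: same_germ_trans (same_germ_sym (same_germ_res i2 b _)) => //.
apply: f_inj => // y [[Uy Uy'] Vy].
by rewrite !f_res //; apply: h.
Qed.

(** As values of [f] determine germs and conversely, a section of the associated sheaf amounts to a
    function that is locally a value of [f]. *)
Lemma sheaf_lift_bij (G : set (X -> W)) (U : opens X) :
  (forall w, G w <-> (forall x, ~ ocar U x -> w x = 0) /\
    forall x, ocar U x -> exists (V : opens X) (t : psec P V),
      [/\ ocar V x, ocar V `<=` ocar U & forall y, ocar V y -> w y = f t y]) ->
  set_bij (sheafified P U) G (sheaf_lift P f).
Proof.
move=> hG; split.
- move=> a [a0 al]; apply/hG; split=> [x Ux|x Ux].
    rewrite /sheaf_lift; case: pselect => // -[t]; by rewrite a0.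
  have [V [t [Vx VU ht]]] := al x Ux; exists V, t; split=> // y Vy.
  by rewrite (sheaf_lift_germ (t := existT _ V t)) //; apply: ht.
- move=> a b /set_mem[a0 al] /set_mem[b0 bl] ab; apply/funext => x.
  have [Ux|Ux] := pselect (ocar U x); last by rewrite a0 ?b0.
  have [V [s [Vx VU hs]]] := al x Ux; have [V' [t [Vx' VU' ht]]] := bl x Ux.
  rewrite hs // ht //; apply: germ_eq.
  apply: (same_germ_of_values (V := setT)) => //; first exact: openT.
  move=> y _ /= Vy Vy'.
  have := congr1 (fun g => g y) ab.
  rewrite /= (sheaf_lift_germ (t := existT _ V s)) ?hs //.
  by rewrite (sheaf_lift_germ (t := existT _ V' t)) ?ht.
- move=> w /hG[w0 wl].
  pose good x (t : local_section P) := [/\ ocar (tag t) x,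
    ocar (tag t) `<=` ocar U & forall y, ocar (tag t) y -> w y = f (tagged t) y].
  (* The union of the germs of all sections realizing [w] around x. They coincide because values
     determine germs, so no compatible choice has to be made. *)
  pose a x : set (local_section P) := [set u | exists2 t, good x t & same_germ x t u].
  have aE x t : good x t -> a x = germ x t.
    move=> [tx tU ht]; rewrite eqEsubset; split=> u; last by exists t.
    move=> [t' [tx' _ ht']] /(same_germ_trans _); apply.
    apply: (same_germ_of_values (V := setT)) => //; first exact: openT.
    by move=> y _ ty ty'; rewrite -ht // -ht'.
  have ex x : ocar U x -> exists t, good x t.
    by move=> /wl[V [t h]]; exists (existT _ V t).
  exists a; last first.
    apply/funext => x; have [Ux|Ux] := pselect (ocar U x).
      have [t gt] := ex x Ux; have [tx _ ht] := gt.
      by rewrite (sheaf_lift_germ tx (aE _ _ gt)) ht.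
    rewrite w0 // /sheaf_lift; case: pselect => // h.
    have [u [t [tx tU _] _]] := h.
    by case: Ux; apply: tU.
  split=> [x Ux|x Ux].
    rewrite -subset0 => u [t [tx tU _] _].
    by case: Ux; apply: tU.
  have [[V t] [/= Vx VU ht]] := ex x Ux.
  exists V, t; split=> // y Vy; by apply: aE.
Qed.

End Germs.

(** * Generators of symmetric and exterior powers *)

Section PowerSpan.
Variables (kd : power_kind) (R : comPzRingType) (M : lmodType R) (q : nat).
Implicit Types t u : formal_sum M q.

Lemma power_eq_slot0 r (v : {ffun 'I_q -> M}) i :
  power_eq kd [:: (r, subst_slot v i 0)] [::].
Proof.
rewrite -(scale0r (0 : M)); apply: power_trans (power_slotZ _ _ _ _ _ _) _.
by rewrite mulr0; apply: power_coef0.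
Qed.

Section Fixed.
Variables (T : eqType) (F : T -> {ffun 'I_q -> M}) (s : seq T).

Definition power_spanned t : Prop :=
  exists c : T -> R, power_eq kd t [seq (c a, F a) | a <- s].

Lemma power_spanned0 : power_spanned [::].
Proof.
exists (fun=> 0); elim: s => [|a s' IH] /=; first exact: power_refl.
rewrite -(cat0s [::]) -cat1s; apply: power_cat IH.
by apply: power_sym; apply: power_coef0.
Qed.

Lemma power_spanned_cat t u :
  power_spanned t -> power_spanned u -> power_spanned (t ++ u).
Proof.
move=> [c tc] [c' uc]; exists (fun a => c a + c' a).
apply: power_trans (power_cat tc uc) _.
elim: s {tc uc} => [|a s' IH] /=; first exact: power_refl.
apply: (power_trans (u := [:: (c a, F a); (c' a, F a)] ++
   ([seq (c a, F a) | a <- s'] ++ [seq (c' a, F a) | a <- s']))); last first.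
  rewrite -[X in power_eq _ _ X]cat1s; apply: power_cat => //.
  by apply: power_sym; apply: power_coefD.
set l1 := map _ s'; set l2 := map _ s'.
change (power_eq kd ([:: (c a, F a)] ++ (l1 ++ ([:: (c' a, F a)] ++ l2)))
  ([:: (c a, F a)] ++ ([:: (c' a, F a)] ++ (l1 ++ l2)))).
apply: power_cat; first exact: power_refl.
rewrite !catA; apply: power_cat; last exact: power_refl.
exact: power_catC.
Qed.

Lemma power_spanned_mem r a : a \in s -> uniq s -> power_spanned [:: (r, F a)].
Proof.
move=> sa us; exists (fun b => if b == a then r else 0).
have zero s' : a \notin s' ->
    power_eq kd [seq (if b == a then r else 0, F b) | b <- s'] [::].
  elim: s' => [|b s' IH] /=; first by move=> _; apply: power_refl.
  rewrite inE negb_or eq_sym => /andP[/negbTE -> /IH h].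
  rewrite -cat1s -[X in power_eq _ _ X]cats0; apply: power_cat h.
  exact: power_coef0.
elim: s sa us => //= b s' IH; rewrite inE => /orP[/eqP <-|sa] /andP[bs us].
  rewrite eqxx -[X in power_eq _ _ X]cat1s -[X in power_eq _ X]cats0.
  by apply: power_cat; [apply: power_refl|apply: power_sym; apply: zero].
case: eqP => [ba|_]; first by rewrite ba sa in bs.
rewrite -[X in power_eq _ _ X]cat1s -[X in power_eq _ X]cat0s.
by apply: power_cat; [apply: power_sym; apply: power_coef0|apply: IH].
Qed.

Lemma power_spanned_eq t u : power_eq kd t u -> power_spanned u -> power_spanned t.
Proof. by move=> tu [c uc]; exists c; apply: power_trans uc. Qed.

Lemma power_spanned_sum (I : finType) (P : pred I) (a : I -> R) (x : I -> M)
    r (v : {ffun 'I_q -> M}) k :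
  (forall i r', P i -> power_spanned [:: (r', subst_slot v k (x i))]) ->
  power_spanned [:: (r, subst_slot v k (\sum_(i | P i) a i *: x i))].
Proof.
move=> h.
elim/big_rec: _ => [|i y Pi IH].
  exact: power_spanned_eq (power_eq_slot0 _ _ _) power_spanned0.
apply: power_spanned_eq (power_slotD _ _ _ _ _ _) _.
rewrite -cat1s; apply: power_spanned_cat => //.
by apply: power_spanned_eq (power_slotZ _ _ _ _ _ _) _; apply: h.
Qed.

(** Slots are expanded one at a time: those from [N] on already hold generators. This is no
    condition for N = q, and N = 0 is a product of generators. *)
Lemma power_spanned_all (I : finType) (P : pred I) (phi : I -> M) :
  (forall x, exists a : I -> R, x = \sum_(i | P i) a i *: phi i) ->
  (forall r (g : 'I_q -> I), (forall k, P (g k)) ->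
     power_spanned [:: (r, [ffun k => phi (g k)])]) ->
  forall t, power_spanned t.
Proof.
move=> gen word; elim=> [|[r v] t IH]; first exact: power_spanned0.
rewrite -cat1s; apply: power_spanned_cat => {IH t}//.
suff /(_ q r v) h : forall N r (v : {ffun 'I_q -> M}),
    (forall k : 'I_q, (N <= k)%N -> exists2 i, P i & v k = phi i) ->
    power_spanned [:: (r, v)].
  by apply: h => k; rewrite leqNgt ltn_ord.
elim=> [|N IH] {}r {}v hv.
  have [k|g hg] := @fin_all_exists _ (fun=> I) (fun k i => P i /\ v k = phi i).
    by have [i Pi vk] := hv k isT; exists i.
  have -> : v = [ffun k => phi (g k)] by apply/ffunP => k; rewrite ffunE; case: (hg k).
  by apply: word => k; case: (hg k).
have [Nq|qN] := ltnP N q; last first.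
  by apply: IH => k /(leq_trans qN); rewrite leqNgt ltn_ord.
pose k0 := Ordinal Nq.
have -> : v = subst_slot v k0 (v k0)
  by apply/ffunP => k; rewrite ffunE; case: eqP => [->|].
have [a ->] := gen (v k0); apply: power_spanned_sum => i r' Pi; apply: IH => k Nk.
rewrite ffunE; case: eqP => [_|/eqP kk0]; first by exists i.
by apply: hv; rewrite ltn_neqAle Nk andbT eq_sym.
Qed.

End Fixed.
End PowerSpan.

(** * A local basis of F *)

Section LocalBasis.
Variables (K : fieldType) (S : standardGradedDomain K).
Local Notation L := {fraction S}.
Local Notation ext0 U f := (patch (fun=> 0) (ocar U) f).

Lemma twist_const d (U : opens (proj_space S)) k (a f : S) :
  hpart (k + d) a -> hpart k f -> (forall y, ocar U y -> ~ proj_ideal y f) ->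
  twist d (ocar U) (ext0 U (fun=> a%:F / f%:F : L)).
Proof.
move=> ha hf Uf; split=> [p Up|p Up]; first by rewrite /patch memNset.
exists (ocar U); split=> //; first exact: ocar_open.
exists k, a, f; split=> // y Uy; split; first exact: Uf.
by rewrite /patch mem_set.
Qed.

Lemma hpartX d (x : S) k : hpart d x -> hpart (d *+ k) (x ^+ k).
Proof.
move=> hx; elim: k => [|k IH]; first exact: hpart1.
by rewrite mulrS exprS; apply: hpartM.
Qed.

Lemma twist_pow (U : opens (proj_space S)) (l : S) (z : int) :
  hpart 1 l -> (forall y, ocar U y -> ~ proj_ideal y l) ->
  twist z (ocar U) (ext0 U (fun=> l%:F ^ z : L)).
Proof.
move=> hl Ul.
have lX k y : ocar U y -> ~ proj_ideal y (l ^+ k).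
  move=> Uy; elim: k => [|k IH]; first exact: proj_ideal1.
  by rewrite exprS; apply: proj_idealM => //; apply: Ul.
case: z => k.
  have := @twist_const k U 0 (l ^+ k) 1; rewrite tofrac1 divr1 tofracXn; apply.
  - by rewrite add0r -natz; apply: hpartX.
  - exact: hpart1.
  - by move=> y _; apply: proj_ideal1.
have := @twist_const (Negz k) U k.+1 1 (l ^+ k.+1); rewrite tofrac1 div1r tofracXn.
apply; [|by rewrite -natz; apply: hpartX|by move=> y; apply: lX].
by rewrite NegzE subrr; apply: hpart1.
Qed.

Lemma open_distinguished d (f : S) : hpart d f ->
  open [set y : proj_space S | ~ proj_ideal y f].
Proof.
move=> hf; exists [set f]; first by move=> x ->; exists d.
rewrite eqEsubset; split=> y /=; first by move=> yf; exists f.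
by move=> [x ->].
Qed.

Lemma open_forall_notin (I : finType) (f : I -> S) (d : I -> int) :
  (forall i, hpart (d i) (f i)) ->
  open [set y : proj_space S | forall i, ~ proj_ideal y (f i)].
Proof.
move=> hf.
have -> : [set y : proj_space S | forall i, ~ proj_ideal y (f i)] =
    [set y | ~ proj_ideal y (\prod_i f i)].
  rewrite eqEsubset; split=> y /= h.
    by elim/big_ind: _ => //; [exact: proj_ideal1|move=> a b; exact: proj_idealM].
  move=> i yi; apply: h; rewrite (bigD1 i) //= mulrC; exact: proj_idealMl.
apply: (@open_distinguished (\sum_i d i)).
elim: (index_enum I) => [|i r IH]; first by rewrite !big_nil; apply: hpart1.
by rewrite !big_cons; apply: hpartM.
Qed.

Hypotheses (nS : is_normal S) (dimS : krull_dim S 2).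
Variables (n m : nat) (e : 'I_n -> int) (d : 'I_m -> int) (A : 'M[S]_(m, n)).
Hypothesis hA : forall j i, hpart (e i - d j) (A j i).
Local Notation c := (fun i => - e i).
Local Notation M := (fun j i => A j i).
Local Notation F := (kersec c M).

Definition kernel_graph_of (B : {set 'I_n}) (C : 'I_n -> 'I_n -> L) : Prop :=
  (forall k i, k \in B -> i \in B -> C k i = (k == i)%:R) /\
  forall v : 'I_n -> L, (forall j, \sum_i (A j i)%:F * v i = 0) <->
     (forall k, v k = \sum_(i in B) C k i * v i).

Lemma val_ker_sum (U : opens (proj_space S)) (I : Type) (r : seq I) (P : pred I)
    (v : I -> F U) y k :
  val (\sum_(i <- r | P i) v i) y k = \sum_(i <- r | P i) val (v i) y k.
Proof.
elim/big_rec2: _ => [|i a b _ <-]; first by rewrite /= ffunE.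
by rewrite val_kerD.
Qed.

(** The basis consists of the columns of [C] indexed by [B]. Entry k of column i has degree e_i -
    e_k but must be a section of O_X(- e_k), whence the factor l^(- e_i). On [W], neither [l] nor
    the denominators chosen for the entries of [C] vanish. *)
Lemma local_basis (U : opens (proj_space S)) x : ocar U x ->
  exists (W : opens (proj_space S)) (B : {set 'I_n}) (C : 'I_n -> 'I_n -> L)
    (l : S) (phi : 'I_n -> F W),
  [/\ ocar W x, ocar W `<=` ocar U, kernel_graph_of B C,
      hpart 1 l /\ (forall y, ocar W y -> ~ proj_ideal y l) &
      (forall y i k, ocar W y -> i \in B ->
         val (phi i) y k = l%:F ^ (- e i) * C k i) /\
      forall v : F W, exists a : 'I_n -> reg W, v = \sum_(i in B) a i *: phi i].
Proof.
move=> Ux.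
have [|B [C [hC CB hv]]] := @kernel_graph _ _ x nS dimS _ e _ (fun j i => (A j i)%:F)
    (fun j => - d j).
  by move=> j i; apply: hloc_hpart (hA j i); apply: prime_set0.
have [l l1 xl] := exists_deg1_notin x.
have [ki|num hnum] := @fin_all_exists ('I_n * 'I_n)%type (fun=> int * (S * S))%type
  (fun ki z => [/\ hpart (z.1 + (e ki.2 - e ki.1)) z.2.1, hpart z.1 z.2.2,
     ~ proj_ideal x z.2.2 & C ki.1 ki.2 = z.2.1%:F / z.2.2%:F]).
  by have [z [a [f h]]] := hC ki.1 ki.2; exists (z, (a, f)).
have oW : open (ocar U `&` ([set y | ~ proj_ideal y l] `&`
    [set y | forall ki, ~ proj_ideal y (num ki).2.2])).
  apply: openI; first exact: ocar_open.
  apply: openI; first exact: open_distinguished l1.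
  by apply: (open_forall_notin (d := fun ki => (num ki).1)) => ki; case: (hnum ki).
pose W := Opens oW.
have Wl y : ocar W y -> ~ proj_ideal y l by move=> [_ []].
have WC k i : twist (e i - e k) (ocar W) (ext0 W (fun=> C k i)).
  have [/= h1 h2 _ ->] := hnum (k, i).
  by apply: (twist_const (U := W) h1 h2) => y [_ [_]]; apply.
have l0 y : ocar W y -> l%:F != 0 :> L by move=> /Wl/proj_neq0.
pose f i : proj_space S -> {ffun 'I_n -> L} :=
  ext0 W (fun=> [ffun k => if i \in B then l%:F ^ (- e i) * C k i else 0]).
have fE i y k : f i y k = if i \in B then
    ext0 W (fun=> l%:F ^ (- e i)) y * ext0 W (fun=> C k i) y else 0.
  rewrite /f /patch; case: ifP => _; rewrite ffunE //.
  by case: ifP => _ //; rewrite mul0r.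
have fP i : f i \in in_mxker c M W.
  apply/in_mxkerP; split.
    move=> k; rewrite (_ : (fun p => f i p k) = fun p => if i \in B then
      ext0 W (fun=> l%:F ^ (- e i)) p * ext0 W (fun=> C k i) p else 0); last first.
      by apply/funext => y; rewrite fE.
    case: (i \in B); last exact: twist0.
    have -> : - e k = - e i + (e i - e k) by ring.
    exact: twistM (twist_pow _ l1 Wl) (WC k i).
  apply/mxactP => y; apply: (hv (f i y)).2 => k; rewrite fE.
  under eq_bigr => i' _ do rewrite fE.
  case: ifPn => iB; last by rewrite big1 // => i' _; rewrite mulr0.
  rewrite /patch; case: ifP => _; last first.
    by rewrite big1 ?mul0r // => i' _; rewrite ?mul0r mulr0.
  rewrite (bigD1 i) //= big1 ?addr0 => [|i' /andP[i'B i'i]].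
    by rewrite (CB i) // eqxx mulr1 mulrC.
  by rewrite (CB i') // (negbTE i'i) !mulr0.
pose phi i : F W := exist (fun s => s \in in_mxker c M W) (f i) (fP i).
have phiE y i k : ocar W y -> i \in B -> val (phi i) y k = l%:F ^ (- e i) * C k i.
  by move=> Wy iB; rewrite /= fE iB /patch mem_set.
exists W, B, C, l, phi; split=> //; first by split=> //; split=> // ki; case: (hnum ki).
  by move=> y [].
split=> // v.
have [vd /mxactP vk] := kersecP v.
have aP i : (fun p => ext0 W (fun=> l%:F ^ e i : L) p * val v p i) \in in_reg W.
  by apply/in_regP; have := twistM (twist_pow (e i) l1 Wl) (vd i); rewrite subrr.
(* The coefficient l^(e_i) v_i undoes the factor in [phi i] and has degree 0. *)
exists (fun i => exist (fun s => s \in in_reg W) _ (aP i)).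
apply: kersec_eq => y k; rewrite val_ker_sum.
under eq_bigr => i iB do rewrite val_kerZ.
have [Wy|Wy] := pselect (ocar W y); last first.
  by rewrite (vd k).1 // big1 // => i _; rewrite /= (vd i).1 // mulr0 mul0r.
rewrite ((hv (val v y)).1 (vk y) k); apply: eq_bigr => i iB.
rewrite phiE //= /patch mem_set // mulrAC mulrA -expfzDr ?(l0 y) // subrr expr0z.
by rewrite mul1r.
Qed.

End LocalBasis.

(** * Kernels on powers of a locally free module *)

Section TwistProducts.
Variables (K : fieldType) (S : standardGradedDomain K) (U : opens (proj_space S)).
Local Notation L := {fraction S}.

Lemma twist_bigsum z (I : Type) (r : seq I) (P : pred I) (f : I -> proj_space S -> L) :
  (forall i, P i -> twist z (ocar U) (f i)) ->
  twist z (ocar U) (fun p => \sum_(i <- r | P i) f i p).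
Proof.
move=> hf; elim: r => [|i r IH].
  have := twist0 z U; congr (twist _ _ _).
  by apply/funext => p; rewrite big_nil.
case Pi : (P i).
  have := twistD (hf i Pi) IH; congr (twist _ _ _).
  by apply/funext => p; rewrite big_cons Pi.
by move: IH; congr (twist _ _ _); apply/funext => p; rewrite big_cons Pi.
Qed.

(* For an empty product this fails: 1 does not vanish off U. *)
Lemma twist_prod q (z : 'I_q -> int) (f : 'I_q -> proj_space S -> L) :
  (0 < q)%N -> (forall k, twist (z k) (ocar U) (f k)) ->
  twist (\sum_k z k) (ocar U) (fun p => \prod_k f k p).
Proof.
case: q z f => // q z f _ hf.
rewrite big_ord_recl (_ : (fun p => _) =
  fun p => f ord0 p * \prod_(k < q) f (lift ord0 k) p); last first.
  by apply/funext => p; rewrite big_ord_recl.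
set s := f ord0; have : twist (z ord0) (ocar U) s by [].
elim: (index_enum 'I_q) (z ord0) s => [|k r IH] z0 s hs.
  rewrite big_nil addr0; move: hs; congr (twist _ _ _).
  by apply/funext => p; rewrite big_nil mulr1.
rewrite big_cons addrA; have := IH _ _ (twistM hs (hf (lift ord0 k))).
by congr (twist _ _ _); apply/funext => p; rewrite big_cons mulrA.
Qed.

End TwistProducts.

Section PowerKernel.
Variables (K : fieldType) (S : standardGradedDomain K).
Hypotheses (nS : is_normal S) (dimS : krull_dim S 2).
Variables (n m q : nat) (e : 'I_n -> int) (d : 'I_m -> int) (A : 'M[S]_(m, n)).
Hypothesis hA : forall j i, hpart (e i - d j) (A j i).
Local Notation L := {fraction S}.
Local Notation c := (fun i => - e i).
Local Notation M := (fun j i => A j i).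
Local Notation F := (kersec c M).
Local Notation ext0 U f := (patch (fun=> 0) (ocar U) f).

(* The summands of the power of the sum E of the O_X(- e_i) are indexed by [T],
   the summand of [a] being generated by the product of the generators
   [word a 0], ..., [word a (q - 1)] of E; [G v a] is the coordinate at [a] of
   the product of [q] elements of E. *)
Variables (kd : power_kind) (T J : finType) (MT : J -> T -> S).
Variables (word : T -> 'I_q -> 'I_n) (G : ('I_q -> {ffun 'I_n -> L}) -> T -> L).

Let cT a : int := - \sum_k e (word a k).

Definition power_coords (U : opens (proj_space S)) (t : power_sec c M q U) :
    proj_space S -> {ffun T -> L} :=
  fun p => [ffun a => \sum_(x <- (t : seq (reg U * {ffun 'I_q -> F U})))
    val x.1 p * G (fun k => val (x.2 k) p) a].

(** The inputs that differ between the two powers. [kernel_determined] serves surjectivity;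
    [G_word], applied to the local basis, makes the coordinates at words in [B] diagonal;
    [power_word] reduces a product to zero or to a multiple of a standard one, whose letters are
    among the old ones and so stay in [B]. *)
Hypothesis coords_eqv : forall U (t u : power_sec c M q U),
  power_eq kd t u -> power_coords t = power_coords u.
Hypothesis G_degree : forall U (v : 'I_q -> F U) a,
  twist (cT a) (ocar U) (fun p => G (fun k => val (v k) p) a).
Hypothesis G_kernel : forall v : 'I_q -> {ffun 'I_n -> L},
  (forall k j, \sum_i (A j i)%:F * v k i = 0) ->
  forall j, \sum_a (MT j a)%:F * G v a = 0.
Hypothesis kernel_determined : forall B C (s : T -> L), kernel_graph_of A B C ->
  (forall j, \sum_a (MT j a)%:F * s a = 0) ->
  (forall a, (forall k, word a k \in B) -> s a = 0) -> forall a, s a = 0.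
Hypothesis G_word : forall (B : {set 'I_n}) (v : 'I_n -> {ffun 'I_n -> L}) x,
  (forall i k, i \in B -> k \in B -> v i k = (i == k)%:R * x i) ->
  forall a b, (forall k, word a k \in B) -> (forall k, word b k \in B) ->
  G (fun k => v (word a k)) b = (a == b)%:R * \prod_k x (word a k).
Hypothesis power_word : forall (R : comPzRingType) (N : lmodType R)
    (phi : 'I_n -> N) r (g : 'I_q -> 'I_n),
  power_eq kd [:: (r, [ffun k => phi (g k)])] [::] \/
  exists a r', (forall k, exists k', word a k = g k') /\
    power_eq kd [:: (r, [ffun k => phi (g k)])]
                [:: (r', [ffun k => phi (word a k)])].

Let inB (B : {set 'I_n}) (a : T) := [forall k, word a k \in B].

Lemma power_spanned_words (R : comPzRingType) (N : lmodType R)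
    (phi : 'I_n -> N) (B : {set 'I_n}) :
  (forall v, exists a : 'I_n -> R, v = \sum_(i in B) a i *: phi i) ->
  forall t, power_spanned kd (fun a => [ffun k => phi (word a k)]) (enum (inB B)) t.
Proof.
move=> gen; apply: power_spanned_all gen _ => r g gB.
have [h|[a [r' [ag h]]]] := power_word phi r g.
  exact: power_spanned_eq h (power_spanned0 _ _ _).
apply: power_spanned_eq h _.
apply: (power_spanned_mem kd (fun a => [ffun k => phi (word a k)])).
  by rewrite mem_enum; apply/forallP => k; have [k' ->] := ag k; apply: gB.
exact: enum_uniq.
Qed.

Lemma power_coords_res (U V : opens (proj_space S)) (h : ocar V `<=` ocar U)
    (t : power_sec c M q U) y :
  ocar V y -> power_coords (power_res h t) y = power_coords t y.
Proof.
move=> Vy; apply/ffunP => a; rewrite !ffunE big_map; apply: eq_bigr => x _.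
rewrite reg_resE mem_set //; congr (_ * G _ _); apply/funext => k.
by rewrite ffunE; apply/ffunP => i; rewrite ker_resE mem_set.
Qed.

Lemma power_coords_mxker (U : opens (proj_space S)) (t : power_sec c M q U) :
  mxker cT MT U (power_coords t).
Proof.
split.
  move=> a; rewrite (_ : (fun p => _) = fun p => \sum_(x <- t)
      val x.1 p * G (fun k => val (x.2 k) p) a); last first.
    by apply/funext => p; rewrite ffunE.
  apply: twist_bigsum => x _; rewrite -[cT a]add0r.
  exact: twistM (regP x.1) (G_degree _ _).
apply/mxactP => p j.
under eq_bigr => a _ do rewrite ffunE mulr_sumr.
rewrite exchange_big /= big1_seq // => x _.
under eq_bigr => a _ do rewrite mulrCA.
rewrite -mulr_sumr G_kernel ?mulr0 // => k j'.
have [_ /mxactP h] := kersecP (x.2 k); exact: h.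
Qed.

Section Local.
Variables (W : opens (proj_space S)) (B : {set 'I_n}) (C : 'I_n -> 'I_n -> L).
Variables (l : S) (phi : 'I_n -> F W).
Hypothesis BC : kernel_graph_of A B C.
Hypothesis l1 : hpart 1 l.
Hypothesis Wl : forall y, ocar W y -> ~ proj_ideal y l.
Hypothesis phiE : forall y i k, ocar W y -> i \in B ->
  val (phi i) y k = l%:F ^ (- e i) * C k i.

Let words (b : T -> reg W) : power_sec c M q W :=
  [seq (b a, [ffun k => phi (word a k)]) | a <- enum (inB B)].

Lemma power_coords_words (b : T -> reg W) y a : ocar W y -> inB B a ->
  power_coords (words b) y a = val (b a) y * l%:F ^ cT a.
Proof.
move=> Wy Ba; rewrite ffunE big_map big_enum /=.
have l0 : l%:F != 0 :> L := proj_neq0 (Wl Wy).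
rewrite (bigD1 a) //= big1 ?addr0 => [|a' /andP[Ba' a'a]].
  have Gw := @G_word B (fun i => val (phi i) y) (fun i => l%:F ^ (- e i)).
  rewrite (_ : (fun k => _) = fun k => val (phi (word a k)) y); last first.
    by apply/funext => k; rewrite ffunE.
  rewrite Gw ?eqxx ?mul1r; first last.
  - exact/forallP.
  - exact/forallP.
  - by move=> i k iB kB; rewrite phiE // BC.1 // mulrC eq_sym.
  congr (_ * _); rewrite /cT; move: (word a) => w.
  rewrite -sumrN; elim: (index_enum 'I_q) => [|k r IH].
    by rewrite !big_nil expr0z.
  by rewrite !big_cons IH expfzDr.
have Gw := @G_word B (fun i => val (phi i) y) (fun i => l%:F ^ (- e i)).
rewrite (_ : (fun k => _) = fun k => val (phi (word a' k)) y); last first.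
  by apply/funext => k; rewrite ffunE.
rewrite Gw ?(negbTE a'a) ?mul0r ?mulr0 //; last exact/forallP; last exact/forallP.
by move=> i k iB kB; rewrite phiE // BC.1 // mulrC eq_sym.
Qed.

(** The coordinate at a word in [B] is the coefficient times a power of [l], which is nonzero on
    [W]. *)
Lemma words_inj (b b' : T -> reg W) :
  (forall y, ocar W y -> power_coords (words b) y = power_coords (words b') y) ->
  words b = words b'.
Proof.
move=> h; apply/eq_in_map => a; rewrite mem_enum => Ba.
congr (_, _); apply: reg_eq => y.
have [Wy|Wy] := pselect (ocar W y); last by rewrite !(regP _).1.
have /ffunP/(_ a) := h y Wy; rewrite !power_coords_words //; apply: mulIf.
by rewrite expfz_neq0 // (proj_neq0 (Wl Wy)).
Qed.

(** The coefficients are the coordinates of [w] brought to degree 0 by powers of [l]. The difference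
    between [w] and the resulting coordinates lies in the kernel and vanishes at words in [B], hence
    everywhere by [kernel_determined]. *)
Lemma mxker_words (w : proj_space S -> {ffun T -> L}) (U : opens (proj_space S)) :
  ocar W `<=` ocar U -> mxker cT MT U w ->
  exists b : T -> reg W, forall y, ocar W y -> w y = power_coords (words b) y.
Proof.
move=> WU [wd /mxactP wk].
have bP a : (fun p => ext0 W (fun p => w p a) p * ext0 W (fun=> l%:F ^ (- cT a)) p)
    \in in_reg W.
  apply/in_regP; rewrite -(subrr (cT a)).
  by apply: twistM; [exact: (twist_res WU (wd a))|exact: twist_pow].
pose b a : reg W := exist (fun s => s \in in_reg W) _ (bP a).
exists b => y Wy; apply/ffunP => a; apply/eqP; rewrite -subr_eq0; apply/eqP.
pose s a := w y a - power_coords (words b) y a.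
apply: (kernel_determined (s := s) BC).
  move=> j; under eq_bigr => a' _ do rewrite mulrBr.
  rewrite sumrB wk; have [_ /mxactP ->] := power_coords_mxker (words b).
  by rewrite subrr.
move=> a' Ba'; rewrite /s power_coords_words //; last exact/forallP.
have l0 : l%:F != 0 :> L := proj_neq0 (Wl Wy).
by rewrite /= /patch mem_set // -mulrA -expfzDr // addNr expr0z mulr1 subrr.
Qed.

End Local.

Lemma power_sheaf_bij (U : opens (proj_space S)) :
  set_bij (sheafified (power_presheaf c M kd q) U) (mxker cT MT U)
    (sheaf_lift (power_presheaf c M kd q) power_coords).
Proof.
apply: sheaf_lift_bij.
- exact: coords_eqv.
- move=> V V' h s x Vx; exact: power_coords_res.
- move=> V s t x Vx st.
  have [W [B [C [l [phi [Wx WV BC [l1 Wl] [phiE gen]]]]]]] :=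
    local_basis nS dimS hA Vx.
  have [b sb] := power_spanned_words gen (power_res WV s).
  have [b' tb'] := power_spanned_words gen (power_res WV t).
  exists W, WV, WV; split=> //; change (power_eq kd (power_res WV s) (power_res WV t)).
  apply: power_trans (sb) (power_trans _ (power_sym tb')).
  (* Normal forms with the same coordinates are equal as lists, not merely modulo the relations. *)
  rewrite (words_inj BC Wl phiE (b := b) (b' := b')); first exact: power_refl.
  move=> y Wy; rewrite -(coords_eqv sb) -(coords_eqv tb').
  by rewrite !power_coords_res // (st y (WV y Wy)).
- move=> w; split=> [hw|[w0 wl]].
    split=> [x Ux|x Ux].
      by apply/ffunP => a; rewrite ffunE (hw.1 a).1.
    have [W [B [C [l [phi [Wx WU BC [l1 Wl] [phiE gen]]]]]]] :=
      local_basis nS dimS hA Ux.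
    have [b hb] := mxker_words BC l1 Wl phiE WU hw.
    by eexists W, _; split; [exact: Wx|exact: WU|exact: hb].
  (* Conversely, regularity and the kernel equations are local conditions. *)
  split=> [a|].
    split=> [x Ux|x Ux]; first by rewrite w0 // ffunE.
    have [V [t [Vx VU ht]]] := wl x Ux.
    have [td _] := power_coords_mxker t.
    have [V' [oV Vx' VV [k [b [f [hb hf h]]]]]] := (td a).2 x Vx.
    exists V'; split=> //; first exact: subset_trans VV VU.
    exists k, b, f; split=> // y Vy; have [yf <-] := h y Vy; split=> //.
    by rewrite ht //; apply: VV.
  apply/mxactP => x j; have [Ux|Ux] := pselect (ocar U x); last first.
    by rewrite w0 // big1 // => a _; rewrite ffunE mulr0.
  have [V [t [Vx VU ht]]] := wl x Ux; rewrite ht //.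
  have [_ /mxactP h] := power_coords_mxker t; exact: h.
Qed.


End PowerKernel.

(** * The symmetric power *)

Section MultiIndices.
Variables (n q : nat).
Implicit Types (f g : {ffun 'I_q -> 'I_n}).

Definition has_type f (a : multi n q) : bool :=
  [forall i, #|[pred k | f k == i]| == val a i].

Lemma has_typeP f (a : multi n q) :
  reflect (forall i, #|[pred k | f k == i]| = val a i) (has_type f a).
Proof. by apply: (iffP forallP) => h i; apply/eqP; apply: h. Qed.

Lemma multi_eq k (a b : multi n k) :
  (forall i, val a i = val b i :> nat) -> a = b.
Proof.
by move=> h; apply: val_inj; apply/ffunP => i; apply: val_inj; apply: h.
Qed.

Lemma has_type_uniq f a b : has_type f a -> has_type f b -> a = b.
Proof.
by move=> /has_typeP ha /has_typeP hb; apply: multi_eq => i; rewrite -ha hb.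
Qed.

Lemma has_type_ex f : exists a, has_type f a.
Proof.
have le i : (#|[pred k | f k == i]| < q.+1)%N.
  by rewrite ltnS -[X in (_ <= X)%N](card_ord q) max_card.
pose a : {ffun 'I_n -> 'I_q.+1} := [ffun i => Ordinal (le i)].
have aq : (\sum_i (a i : nat) == q)%N.
  apply/eqP; rewrite -[RHS](card_ord q) -sum1_card.
  rewrite (partition_big f xpredT) //=; apply: eq_bigr => i _.
  by rewrite ffunE /= -sum1_card; apply: eq_bigl => k; rewrite !inE.
by exists (exist _ a aq); apply/has_typeP => i; rewrite /= ffunE.
Qed.

Lemma count_tuple (t : q.-tuple 'I_n) i :
  count_mem i t = #|[pred k | tnth t k == i]|.
Proof.
rewrite -[in LHS](map_tnth_enum t) -sum1_count big_map big_enum_cond -sum1_card.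
by apply: eq_bigl => k; rewrite inE.
Qed.

Lemma word_ex (a : multi n q) : exists f, has_type f a.
Proof.
pose s := flatten [seq nseq (val a i) i | i <- enum 'I_n].
have cs i : count_mem i s = val a i.
  rewrite count_flatten -map_comp sumnE big_map big_enum /= (bigD1 i) //=.
  rewrite count_nseq /= eqxx mul1n big1 ?addn0 // => k ki.
  by rewrite count_nseq /= (negbTE ki) mul0n.
have ss : size s == q.
  rewrite size_flatten /shape -map_comp sumnE big_map big_enum /=.
  rewrite -[X in _ == X](eqP (valP a)); apply/eqP; apply: eq_bigr => i _.
  by rewrite size_nseq.
exists [ffun k => tnth (Tuple ss) k]; apply/has_typeP => i.
rewrite -cs -[RHS]/(count_mem i (Tuple ss)) count_tuple.
by apply: eq_card => k; rewrite !inE ffunE.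
Qed.

(** An arbitrary spelling of the monomial; every other one is a permutation of it, by
    [has_type_perm]. *)
Definition sym_word (a : multi n q) : {ffun 'I_q -> 'I_n} := sval (cid (word_ex a)).

Lemma sym_wordP a : has_type (sym_word a) a.
Proof. exact: svalP (cid (word_ex a)). Qed.

Lemma has_type_perm f g a : has_type f a -> has_type g a ->
  exists s : 'S_q, forall k, f k = g (s k).
Proof.
move=> /has_typeP fa /has_typeP ga.
have cnt (h : {ffun 'I_q -> 'I_n}) i :
    count_mem i [tuple h k | k < q] = #|[pred k | h k == i]|.
  by rewrite count_tuple; apply: eq_card => k; rewrite !inE tnth_mktuple.
have /tuple_permP[s hs] : perm_eq [tuple f k | k < q] [tuple g k | k < q].
  by apply/allP => i _ /=; rewrite !cnt fa ga.
exists s => k.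
have := congr1 (fun t => nth (f k) t k) hs.
rewrite /= (nth_map k) ?size_enum_ord // nth_ord_enum => ->.
by rewrite (nth_map k) ?size_enum_ord // nth_ord_enum tnth_mktuple.
Qed.

Lemma sum_has_type (V : nmodType) f a (F : 'I_n -> V) : has_type f a ->
  \sum_k F (f k) = \sum_i F i *+ val a i.
Proof.
move=> /has_typeP fa; rewrite (partition_big f xpredT) //=.
apply: eq_bigr => i _; rewrite -fa -sumr_const.
by apply: eq_big => [k|k /eqP ->]; rewrite ?inE.
Qed.

Hypothesis q0 : (0 < q)%N.

Lemma madd_subproof (b : multi n q.-1) i k : (val b k + (k == i) < q.+1)%N.
Proof.
have bk : (val b k <= q.-1)%N by rewrite -ltnS.
move: (nat_of_ord (val b k)) bk => x xq.
by rewrite ltnS -(prednK q0) -addn1 leq_add // leq_b1.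
Qed.

Lemma madd_sum (b : multi n q.-1) i :
  (\sum_k ([ffun k => Ordinal (madd_subproof b i k)] k : nat) == q)%N.
Proof.
apply/eqP; under eq_bigr => k _ do rewrite ffunE /=.
rewrite big_split /= (eqP (valP b)) (bigD1 i) //= eqxx big1 => [|k /negbTE ->//].
by rewrite addn0 addn1 prednK.
Qed.

Definition madd (b : multi n q.-1) i : multi n q :=
  exist (fun a : {ffun 'I_n -> 'I_q.+1} => \sum_i (a i : nat) == q)%N _ (madd_sum b i).

Lemma val_madd b i k : val (madd b i) k = (val b k + (k == i))%N :> nat.
Proof. by rewrite /= ffunE. Qed.

Lemma madd_ex (a : multi n q) i : (0 < val a i)%N -> exists b, a = madd b i.
Proof.
move=> ai.
have sa : (val a i + \sum_(k | k != i) (val a k : nat) = q)%N.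
  by rewrite -[RHS](eqP (valP a)) [RHS](bigD1 i).
have le k : (val a k - (k == i) < q.-1.+1)%N.
  rewrite prednK //; have [->|ki] := eqVneq k i.
    by have := ltn_ord (val a i); rewrite ltnS => h; rewrite subn1 prednK.
  rewrite subn0; rewrite -[X in (_ < X)%N]sa (bigD1 k) //= addnA.
  by apply: leq_trans (leq_addr _ _); rewrite -add1n leq_add2r.
pose b : {ffun 'I_n -> 'I_q.-1.+1} := [ffun k => Ordinal (le k)].
have sb : (\sum_i (b i : nat) == q.-1)%N.
  rewrite (bigD1 i) //= ffunE /= eqxx.
  rewrite (eq_bigr (fun k => val a k : nat)) => [|k ki].
    have key (x y z : nat) : (x + y = z)%N -> (0 < x)%N -> (x - 1 + y = z.-1)%N.
      by case: x => // x <- _; rewrite subn1.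
    by apply/eqP; exact: key sa ai.
  by rewrite ffunE /= (negbTE ki) subn0.
exists (exist _ b sb); apply: multi_eq => k; rewrite val_madd /= ffunE /=.
by have [->|] := eqVneq k i; rewrite ?addn0 ?subn0 // subnK.
Qed.

Lemma madd_inj b : injective (madd b).
Proof.
move=> i i' /(congr1 (fun a : multi n q => val a i : nat)).
by rewrite !val_madd eqxx => /addnI; case: eqP.
Qed.

End MultiIndices.

Section SymmetricPower.
Variables (K : fieldType) (S : standardGradedDomain K).
Hypotheses (K0 : [pchar K] =i pred0) (nS : is_normal S) (dimS : krull_dim S 2).
Variables (n m q : nat) (e : 'I_n -> int) (d : 'I_m -> int) (A : 'M[S]_(m, n)).
Hypothesis hA : forall j i, hpart (e i - d j) (A j i).
Hypothesis q0 : (0 < q)%N.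
Local Notation L := {fraction S}.
Local Notation c := (fun i => - e i).
Local Notation M := (fun j i => A j i).
Local Notation F := (kersec c M).

Lemma natf_neq0 k : (k.+1)%:R != 0 :> L.
Proof.
have : (k.+1)%:R != 0 :> K by rewrite ((pcharf0P K).1 K0).
apply: contra_neq => /eqP; rewrite -(rmorph_nat (@FracField.tofrac S)) tofrac_eq0.
by rewrite -(rmorph_nat (sgd_struct S)) fmorph_eq0 => /eqP.
Qed.

Lemma sym_matrix_madd (b : multi n q.-1) j i :
  sym_matrix q A (b, j) (madd q0 b i) = A j i *+ (val b i).+1.
Proof.
rewrite /sym_matrix ifF; last first.
  by apply/existsP => -[k]; rewrite val_madd ltnNge leq_addr.
case: pickP => [k|/(_ i)]; last by rewrite val_madd eqxx addn1 ltnSn.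
rewrite val_madd; have [->|ki] := eqVneq k i; last by rewrite addn0 ltnn.
by rewrite addn1.
Qed.

(** If a >= b and a_i > b_i, then a = b' + 1_i with b' >= b, and equality of the sums forces b' =
    b. *)
Lemma sym_matrix_eq0 (b : multi n q.-1) j (a : multi n q) :
  (forall i, a != madd q0 b i) -> sym_matrix q A (b, j) a = 0.
Proof.
move=> ab; rewrite /sym_matrix; case: ifPn => //= /existsPn ba.
case: pickP => // i bi; have [b' ab'] := @madd_ex _ _ q0 a i (leq_ltn_trans (leq0n _) bi).
case/eqP: (ab i); rewrite ab'; congr madd.
have le k : (val b k <= val b' k)%N.
  have := ba k; rewrite -leqNgt ab' val_madd.
  have [->|_] := eqVneq k i; last by rewrite addn0.
  by move: bi; rewrite ab' val_madd eqxx addn1 ltnS.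
apply: multi_eq => k; apply/eqP; rewrite eq_sym; move: k; apply/forallP.
have : (\sum_k (val b k : nat) == \sum_k (val b' k : nat))%N.
  by rewrite (eqP (valP b)) (eqP (valP b')).
rewrite (leqif_sum (fun k _ => leqif_eq (le k))).2 => /forallP h.
by apply/forallP => k; have := h k; rewrite eq_sym.
Qed.

(** A row of A_q acts as a row of A on the vector of the (b_i + 1) X(b + 1_i). Both
    [sym_coord_kernel] and [sym_kernel_determined] rest on this. *)
Lemma sym_matrix_sum (b : multi n q.-1) j (X : multi n q -> L) :
  \sum_a (sym_matrix q A (b, j) a)%:F * X a =
  \sum_i (A j i)%:F * ((val b i).+1%:R * X (madd q0 b i)).
Proof.
rewrite (bigID (fun a => a \in [set madd q0 b i | i : 'I_n]%SET)) /= addrC big1 ?add0r.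
  rewrite big_imset /=; last by move=> i i' _ _; apply: madd_inj.
  apply: eq_bigr => i _.
  by rewrite sym_matrix_madd tofracMn -[_ *+ _]mulr_natr -mulrA.
move=> a ab; rewrite sym_matrix_eq0 ?tofrac0 ?mul0r // => i.
by apply: contra ab => /eqP ->; apply: imset_f.
Qed.

Definition sym_coord (v : 'I_q -> {ffun 'I_n -> L}) (a : multi n q) : L :=
  \sum_(f : {ffun 'I_q -> 'I_n} | has_type f a) \prod_k v k (f k).

Lemma sym_degree (a : multi n q) (f : {ffun 'I_q -> 'I_n}) : has_type f a ->
  \sum_k - e (f k) = sym_twists q e a.
Proof. by move=> fa; rewrite sumrN (sum_has_type _ fa). Qed.

(* The sum over i of (b_i + 1) A_ji times the coordinate at b + 1_i is a sum over
   the words f and the marked letters k of f such that f without its k-th letter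
   has type b; the sum over the letters at k is then A_j applied to v_k. *)
Lemma sym_coord_kernel (v : 'I_q -> {ffun 'I_n -> L}) :
  (forall k j, \sum_i (A j i)%:F * v k i = 0) ->
  forall bj, \sum_a (sym_matrix q A bj a)%:F * sym_coord v a = 0.
Proof.
move=> vA [b j]; rewrite sym_matrix_sum.
pose off k (f : {ffun 'I_q -> 'I_n}) :=
  [forall i, #|[pred l | (l != k) && (f l == i)]| == val b i].
have offE k (f : {ffun 'I_q -> 'I_n}) : has_type f (madd q0 b (f k)) = off k f.
  apply: eq_forallb => i; rewrite val_madd (cardD1 k) inE addnC (eq_sym i) eqn_add2r.
  by congr (_ == _); apply: eq_card => l; rewrite !inE.
(* A word of type b + 1_i contains the letter i exactly b_i + 1 times, so the factor counts the ways
   to mark one of them. *)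
have step i : (val b i).+1%:R * sym_coord v (madd q0 b i) =
    \sum_k \sum_(f : {ffun 'I_q -> 'I_n} | (f k == i) && off k f)
      \prod_l v l (f l).
  rewrite (exchange_big_dep (fun f => has_type f (madd q0 b i))) /=; last first.
    by move=> k f _ /andP[/eqP <-]; rewrite offE.
  rewrite mulr_sumr; apply: eq_bigr => f fa.
  rewrite [RHS](eq_bigl (fun k => f k == i)) => [|k]; last first.
    by apply: andb_idr => /eqP fk; rewrite -offE fk.
  rewrite sumr_const mulr_natl; congr (_ *+ _).
  by have /has_typeP/(_ i) := fa; rewrite val_madd eqxx addn1 => <-; apply: eq_card.
under eq_bigr => i _ do rewrite step mulr_sumr.
rewrite exchange_big /= big1 // => k _.
case: (pickP (fun _ : 'I_n => true)) => [i0 _|no]; last first.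
  by rewrite big1 // => i; have := no i.
(* Words that agree away from k are represented by the one with the fixed letter [i0] at k, so that
   the inner sum has an index set independent of i. *)
pose upd i (f : {ffun 'I_q -> 'I_n}) := [ffun l => if l == k then i else f l].
have updoff i f : off k (upd i f) = off k f.
  apply: eq_forallb => i'; congr (_ == _); apply: eq_card => l; rewrite !inE.
  by rewrite ffunE; case: eqP.
have inner i : \sum_(f : {ffun 'I_q -> 'I_n} | (f k == i) && off k f) \prod_l v l (f l) =
    \sum_(f : {ffun 'I_q -> 'I_n} | (f k == i0) && off k f)
      v k i * \prod_(l | l != k) v l (f l).
  rewrite (reindex_onto (upd i) (upd i0)) /=; last first.
    move=> f /andP[/eqP fk _]; apply/ffunP => l; rewrite !ffunE.
    by case: eqP => // ->.
  apply: eq_big => [f|f _].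
    rewrite updoff ffunE !eqxx /= andbC; congr (_ && _).
    apply/eqP/eqP => [/ffunP/(_ k)|fk].
      by rewrite !ffunE eqxx.
    by apply/ffunP => l; rewrite !ffunE; case: eqP => // ->.
  rewrite (bigD1 k) //= ffunE eqxx; congr (_ * _); apply: eq_bigr => l lk.
  by rewrite ffunE (negbTE lk).
under eq_bigr => i _ do rewrite inner mulr_sumr.
rewrite exchange_big /= big1 // => f _.
under eq_bigr => i _ do rewrite mulrA.
by rewrite -mulr_suml vA mul0r.
Qed.

Lemma sym_kernel_determined B C (s : multi n q -> L) : kernel_graph_of A B C ->
  (forall bj, \sum_a (sym_matrix q A bj a)%:F * s a = 0) ->
  (forall a, (forall k, sym_word a k \in B) -> s a = 0) -> forall a, s a = 0.
Proof.
move=> [_ hker] sA sB a.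
pose N (a : multi n q) := (\sum_(i | i \notin B) (val a i : nat))%N.
have [k] := ubnP (N a); elim: k a => // k IH a; rewrite ltnS => Na.
have [[i [iB ai]]|h] := pselect (exists i, i \notin B /\ (0 < val a i)%N); last first.
  apply: sB => l; apply: contrapT => /negP lB; apply: h.
  exists (sym_word a l); split=> //.
  have /has_typeP <- := sym_wordP a; apply/card_gt0P; exists l.
  by rewrite inE.
have [b ab] := madd_ex q0 ai.
pose w i := (val b i).+1%:R * s (madd q0 b i).
have wA j : \sum_i (A j i)%:F * w i = 0.
  by rewrite -sym_matrix_sum.
(* Trading the letter i for some i' in [B] lowers [N], so each term on the right vanishes by
   induction; b_i + 1 is nonzero in characteristic 0. *)
have := (hker w).1 wA i; rewrite big1 => [/eqP|i' i'B].
  by rewrite mulf_eq0 (negbTE (natf_neq0 _)) /= -ab => /eqP.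
rewrite /w IH ?mulr0 //; apply: leq_trans Na.
rewrite /N ab !(bigD1 i iB) /= !val_madd eqxx addn1.
have -> : (i == i') = false by apply: contraNF iB => /eqP ->.
rewrite addn0 addSn ltnS leq_add2l; apply: leq_sum => l /andP[lB li].
rewrite !val_madd (negbTE li) leq_add2l; case: eqP => // li'.
by rewrite li' i'B in lB.
Qed.

(** A word of type b is a permutation of [sym_word b], so its letters lie in [B], where the vectors
    are diagonal; its product vanishes unless the word is [sym_word a] itself. *)
Lemma sym_coord_word (B : {set 'I_n}) (v : 'I_n -> {ffun 'I_n -> L}) x :
  (forall i k, i \in B -> k \in B -> v i k = (i == k)%:R * x i) ->
  forall a b, (forall k, sym_word a k \in B) -> (forall k, sym_word b k \in B) ->
  sym_coord (fun k => v (sym_word a k)) b = (a == b)%:R * \prod_k x (sym_word a k).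
Proof.
move=> vx a b aB bB.
have fB (f : {ffun 'I_q -> 'I_n}) : has_type f b -> forall k, f k \in B.
  by move=> /has_type_perm/(_ (sym_wordP b))[s fs] k; rewrite fs.
have zero (f : {ffun 'I_q -> 'I_n}) : has_type f b -> f != sym_word a ->
    \prod_k v (sym_word a k) (f k) = 0.
  move=> fb fa; apply/eqP; rewrite prodf_seq_eq0; apply/hasP.
  have [k fk] : exists k, f k != sym_word a k.
    apply/existsP; apply: contraR fa; rewrite negb_exists => /forallP h.
    by apply/eqP/ffunP => k; apply/eqP; have := h k; rewrite negbK.
  exists k; first exact: mem_index_enum.
  have := vx (sym_word a k) (f k) (aB k) (fB f fb k).
  by rewrite eq_sym (negbTE fk) mul0r => ->; rewrite eqxx.
have [ab|ab] := eqVneq a b; last first.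
  rewrite mul0r /sym_coord big1 // => f fb; apply: zero => //.
  apply: contra_neq ab => fa; rewrite fa in fb.
  exact: has_type_uniq (sym_wordP a) fb.
subst b; rewrite mul1r /sym_coord (bigD1 (sym_word a)) ?sym_wordP //=.
rewrite [X in _ + X]big1 ?addr0 //.
  by apply: eq_bigr => k _; rewrite vx // eqxx mul1r.
by move=> f /andP[fa fw]; apply: zero.
Qed.

Lemma sym_power_word (R : comPzRingType) (N : lmodType R) (phi : 'I_n -> N) r
    (g : 'I_q -> 'I_n) :
  power_eq SymPower [:: (r, [ffun k => phi (g k)])] [::] \/
  exists (a : multi n q) r', (forall k, exists k', sym_word a k = g k') /\
    power_eq SymPower [:: (r, [ffun k => phi (g k)])]
                [:: (r', [ffun k => phi (sym_word a k)])].
Proof.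
right; have [a ga] := has_type_ex [ffun k => g k].
have [s hs] := has_type_perm (sym_wordP a) ga.
exists a, r; split=> [k|]; first by exists (s k); rewrite hs ffunE.
have := power_perm r [ffun k => phi (g k)] s (erefl SymPower).
congr (power_eq _ _ [:: (_, _)]); apply/ffunP => k.
by rewrite !ffunE hs ffunE.
Qed.

Lemma sym_power_bij (U : opens (proj_space S)) :
  set_bij (sym_sheaf q e A U) (mxker (sym_twists q e) (sym_matrix q A) U)
    (sym_map q e A).
Proof.
have tw : sym_twists q e = fun a => - \sum_k e (sym_word a k).
  by apply/funext => a; rewrite (sum_has_type _ (sym_wordP a)).
rewrite tw; apply: (power_sheaf_bij nS dimS hA (G := sym_coord)).
- by move=> V t u; apply: sym_coords_eq.
- move=> V v a; rewrite -[X in twist X](congr1 (fun f => f a) tw).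
  apply: twist_bigsum => f fa; rewrite -(sym_degree fa).
  apply: (@twist_prod _ _ _ q (fun k => - e (f k)) (fun k p => val (v k) p (f k))) => // k.
  by have [] := kersecP (v k).
- exact: sym_coord_kernel.
- exact: sym_kernel_determined.
- exact: sym_coord_word.
- exact: sym_power_word.
Qed.

End SymmetricPower.

(** * The exterior power *)

Section KSubsets.
Variable n : nat.

Lemma ksubset_elt_in k (I : ksubset n k) l : ksubset_elt I l \in val I.
Proof. exact: enum_valP. Qed.

Lemma ksubset_elt_inj k (I : ksubset n k) : injective (ksubset_elt I).
Proof. by move=> l l' /enum_val_inj/cast_ord_inj. Qed.

Lemma ksubset_elt_surj k (I : ksubset n k) i : i \in val I ->
  exists l, i = ksubset_elt I l.
Proof.
move=> iI; exists (cast_ord (eqP (valP I)) (enum_rank_in iI i)).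
by rewrite /ksubset_elt cast_ordK enum_rankK_in.
Qed.

Lemma ksubset_elt_le k (I : ksubset n k) l l' :
  (ksubset_elt I l <= ksubset_elt I l')%N = (l <= l')%N.
Proof.
have [ll'|l'l] := leqP l l'.
  move: ll'; rewrite leq_eqVlt => /orP[/eqP/val_inj ->|/(ksubset_elt_mono I)/ltnW ->//].
  exact: leqnn.
by apply/negbTE; rewrite -ltnNge; apply: ksubset_elt_mono.
Qed.

Lemma increasing_uniq k (f g : 'I_k -> 'I_n) :
  (forall l l' : 'I_k, (l < l')%N -> (f l < f l')%N) ->
  (forall l l' : 'I_k, (l < l')%N -> (g l < g l')%N) ->
  (forall i, (exists l, i = f l) <-> (exists l, i = g l)) -> f =1 g.
Proof.
move=> hf hg fg.
have srt (h : 'I_k -> 'I_n) : (forall l l' : 'I_k, (l < l')%N -> (h l < h l')%N) ->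
    sorted (fun i j : 'I_n => i < j)%N (codom h).
  move=> hh; rewrite codomE.
  apply: (homo_sorted (e := fun l l' : 'I_k => (l < l')%N)) => //.
  have := iota_ltn_sorted 0 k; rewrite -val_enum_ord sorted_map.
  by [].
have e : codom f = codom g.
  apply: (irr_sorted_eq (leT := fun i j : 'I_n => (i < j)%N)).
  - by move=> x y z; apply: ltn_trans.
  - by move=> x; apply: ltnn.
  - exact: srt.
  - exact: srt.
  - move=> i; apply/codomP/codomP => [[l il]|[l il]].
      by apply/fg; exists l.
    by apply/fg; exists l.
move=> l; have := congr1 (fun s => nth (f l) s (enum_rank l)) e.
by rewrite !nth_codom enum_rankK.
Qed.

(** Positions count from 1 and slots from 0: the elements up to that of slot l fill l + 1 slots. *)
Lemma ksubset_pos_elt k (I : ksubset n k) l :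
  ksubset_pos (ksubset_elt I l) (val I) = l.+1.
Proof.
rewrite /ksubset_pos.
pose h (x : 'I_l.+1) := ksubset_elt I (widen_ord (ltn_ord l) x).
have hinj : injective h.
  by move=> x y /ksubset_elt_inj/(congr1 val) /= xy; apply: val_inj.
rewrite -[RHS]card_ord -(card_codom hinj); apply: eq_card => i.
rewrite !inE; apply/andP/codomP => [[iI il]|[x ->]]; last first.
  by rewrite ksubset_elt_in ksubset_elt_le /= -ltnS.
have [l' il'] := ksubset_elt_surj iI.
move: il; rewrite il' ksubset_elt_le -ltnS => l'l.
by exists (Ordinal l'l); congr ksubset_elt; apply: val_inj.
Qed.

End KSubsets.

(** * Permuting the factors of an exterior product *)

Section AlternatingSign.
Variables (R : comPzRingType) (N : lmodType R) (q : nat).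
Implicit Types (v : {ffun 'I_q -> N}).

(** Formal sums have no subtraction; a term changes sides with its coefficient negated. *)
Lemma power_eq_cat_cancel (t u : formal_sum N q) r v :
  power_eq ExtPower (t ++ [:: (r, v)]) u -> power_eq ExtPower t (u ++ [:: (- r, v)]).
Proof.
move=> h; apply: power_trans (power_cat h (power_refl _ [:: (- r, v)])).
rewrite -catA -[X in power_eq _ X]cats0; apply: power_cat; first exact: power_refl.
apply: power_trans (power_sym (power_coef0 _ v)) _.
by rewrite -(subrr r); apply: power_coefD.
Qed.

(** Polarization: with x and y the entries of [v] at i and j, expand the product having x + y in
    both slots. It vanishes, and so do the two terms with equal entries. *)
Lemma power_eq_tperm r v i j : i != j ->
  power_eq ExtPower [:: (r, [ffun k => v (tperm i j k)])] [:: (- r, v)].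
Proof.
move=> ij; pose w x y := subst_slot (subst_slot v i x) j y.
have wC x y : w x y = subst_slot (subst_slot v j y) i x.
  apply/ffunP => k; rewrite !ffunE; case: (eqVneq k j) => [->|] //.
  by rewrite eq_sym (negbTE ij).
have wi x y : w x y i = x by rewrite !ffunE (negbTE ij) eqxx.
have wj x y : w x y j = y by rewrite !ffunE eqxx.
have alt x : power_eq ExtPower [:: (r, w x x)] [::].
  by apply: (power_alt _ _ ij) => //; rewrite wi wj.
have -> : [ffun k => v (tperm i j k)] = w (v j) (v i).
  apply/ffunP => k; rewrite !ffunE; case: tpermP => [->|->|/eqP ki /eqP kj].
  - by rewrite eqxx (negbTE ij).
  - by rewrite eqxx.
  - by rewrite (negbTE ki) (negbTE kj).
have vE : v = w (v i) (v j).
  apply/ffunP => k; rewrite !ffunE.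
  by case: eqP => [->//|_]; case: eqP => [->|].
suff: power_eq ExtPower [:: (r, w (v j) (v i))] [:: (- r, w (v i) (v j))].
  by rewrite -vE.
set x := v i; set y := v j.
have := alt (x + y).
have D1 : power_eq ExtPower [:: (r, w (x + y) (x + y))]
    ([:: (r, w (x + y) x)] ++ [:: (r, w (x + y) y)]) by apply: power_slotD.
have D2 z : power_eq ExtPower [:: (r, w (x + y) z)]
    ([:: (r, w x z)] ++ [:: (r, w y z)]) by rewrite !wC; apply: power_slotD.
move=> h; rewrite -[X in power_eq _ _ X]cat0s; apply: power_eq_cat_cancel.
apply: power_trans (power_trans (power_sym D1) h).
apply: power_trans (power_cat (power_sym (D2 x)) (power_sym (D2 y))).
apply: power_cat.
  rewrite -[X in power_eq _ X]cat0s; apply: power_cat; last exact: power_refl.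
  exact/power_sym.
rewrite -[X in power_eq _ X]cats0; apply: power_cat; first exact: power_refl.
exact/power_sym.
Qed.

(** The permutation is a product of transpositions, each negating the coefficient. The sign is left
    unspecified, as only the span matters later. *)
Lemma power_eq_perm r v (s : 'S_q) :
  exists r', power_eq ExtPower [:: (r, [ffun k => v (s k)])] [:: (r', v)].
Proof.
have [ts -> dts] := prod_tpermP s.
elim: ts r dts => [|t ts IH] r /=.
  move=> _; exists r; rewrite big_nil.
  have -> : [ffun k => v ((1%g : 'S_q) k)] = v by apply/ffunP => k; rewrite ffunE perm1.
  exact: power_refl.
move=> /andP[t12 /(IH (- r))[r' h]]; exists r'; apply: power_trans h.
have := power_eq_tperm r [ffun k => v ((\prod_(t <- ts) tperm t.1 t.2)%g k)] t12.
congr (power_eq _ [:: (_, _)]); apply/ffunP => k.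
by rewrite !ffunE big_cons permM.
Qed.

End AlternatingSign.

Section ExteriorPower.
Variables (K : fieldType) (S : standardGradedDomain K).
Hypotheses (nS : is_normal S) (dimS : krull_dim S 2).
Variables (n m q : nat) (e : 'I_n -> int) (d : 'I_m -> int) (A : 'M[S]_(m, n)).
Hypothesis hA : forall j i, hpart (e i - d j) (A j i).
Local Notation L := {fraction S}.
Local Notation c := (fun i => - e i).
Local Notation M := (fun j i => A j i).
Local Notation F := (kersec c M).

(* [X] at the subset [s], and 0 if [s] does not have [q.+1] elements. *)
Definition ext_at (X : ksubset n q.+1 -> L) (s : {set 'I_n}) : L :=
  \sum_(I | val I == s) X I.

Lemma ext_at_val X I : ext_at X (val I) = X I.
Proof. by rewrite /ext_at (big_pred1 I) // => I'; rewrite (inj_eq val_inj). Qed.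

Lemma ext_at_card X (s : {set 'I_n}) : #|s| != q.+1 -> ext_at X s = 0.
Proof.
move=> sq; rewrite /ext_at big1 // => I /eqP Is; case/eqP: sq.
by rewrite -Is (eqP (valP I)).
Qed.

Lemma card_setU1_mem (J : ksubset n q) i : i \in val J -> #|(i |: val J)%SET| != q.+1.
Proof.
move=> iJ; rewrite (finset.setUidPr _) ?finset.sub1set // (eqP (valP J)).
by rewrite neq_ltn ltnSn.
Qed.

(** The analogue of [sym_matrix_sum]. For i in [J] the union has only q elements and [ext_at] gives
    0, so i may range over all indices. *)
Lemma ext_matrix_sum (J : ksubset n q) j X :
  \sum_I (ext_matrix q.+1 A (J, j) I)%:F * X I =
  \sum_i (A j i)%:F * ((-1) ^+ ksubset_pos i (i |: val J)%SET * ext_at X (i |: val J)%SET).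
Proof.
transitivity (\sum_I \sum_(i | val I == (i |: val J)%SET)
    (A j i)%:F * ((-1) ^+ ksubset_pos i (val I) * X I)); last first.
  rewrite (exchange_big_dep xpredT) //=; apply: eq_bigr => i _.
  by rewrite /ext_at !mulr_sumr; apply: eq_bigr => I /eqP ->.
apply: eq_bigr => I _; rewrite /ext_matrix /=.
case: ifPn => JI; last first.
  rewrite tofrac0 mul0r big1 // => i /eqP IJ; case/negP: JI.
  by rewrite IJ finset.subsetUr.
have : #|val I :\: val J| = 1%N.
  by rewrite cardsD (finset.setIidPr JI) (eqP (valP I)) (eqP (valP J)) subSnn.
move=> /eqP/cards1P[i IJ].
have iI : i \in (val I :\: val J)%SET by rewrite IJ finset.set11.
case: pickP => [i'|/(_ i)]; last by rewrite iI.
rewrite IJ finset.in_set1 => /eqP -> {i'}.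
rewrite (big_pred1 i) => [|i'].
  by rewrite tofracM tofracXn tofracN tofrac1; ring.
apply/eqP/eqP => [Ii'|->].
  have : i \in (i' |: val J)%SET by rewrite -Ii'; move: iI; rewrite inE => /andP[].
  by rewrite !inE => /orP[/eqP ->//|iJ]; move: iI; rewrite inE iJ.
by rewrite -[LHS](finset.setID _ (val J)) (finset.setIidPr JI) IJ finset.setUC.
Qed.

Definition ext_coord (v : 'I_q.+1 -> {ffun 'I_n -> L}) (I : ksubset n q.+1) : L :=
  \det (\matrix_(k, l) v k (ksubset_elt I l)).

(** The coordinate of v_0 /\ ... /\ v_q at u_i /\ u_J, with i in front instead of in its place. It
    makes sense for i in [J] too, and its cofactors along the first column do not depend on i. *)
Definition bordered_det (v : 'I_q.+1 -> {ffun 'I_n -> L}) (J : ksubset n q) i : L :=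
  \det (\matrix_(k, l)
     if unlift ord0 l is Some l' then v k (ksubset_elt J l') else v k i).

Definition bordered_cofactor (v : 'I_q.+1 -> {ffun 'I_n -> L}) (J : ksubset n q)
    (k : 'I_q.+1) : L :=
  (-1) ^+ k * \det (\matrix_(a < q, b < q) v (lift k a) (ksubset_elt J b)).

Lemma bordered_detE v J i :
  bordered_det v J i = \sum_k v k i * bordered_cofactor v J k.
Proof.
rewrite /bordered_det (expand_det_col _ ord0); apply: eq_bigr => k _.
rewrite !mxE unlift_none /cofactor addn0; congr (_ * (_ * \det _)).
by apply/matrixP => a b; rewrite !mxE liftK.
Qed.

(** Moving the column of i from slot l to the front costs (-1)^l, while the position of i is l + 1;
    the two signs multiply to -1 for every i. For i in [J] the bordered matrix has two equal
    columns. *)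
Lemma ext_at_coord v (J : ksubset n q) i :
  (-1) ^+ ksubset_pos i (i |: val J)%SET * ext_at (ext_coord v) (i |: val J)%SET =
  - bordered_det v J i.
Proof.
have [iJ|iJ] := boolP (i \in val J).
  rewrite ext_at_card ?card_setU1_mem // mulr0 /bordered_det -det_tr.
  have [l il] := ksubset_elt_surj iJ.
  rewrite (determinant_alternate (i1 := ord0) (i2 := lift ord0 l)) ?oppr0 //.
  by move=> k; rewrite !mxE unlift_none liftK -il.
have cI : #|(i |: val J)%SET| == q.+1.
  by rewrite cardsU1 iJ (eqP (valP J)).
pose I : ksubset n q.+1 := exist (fun I : {set 'I_n} => #|I| == q.+1) _ cI.
have -> : (i |: val J)%SET = val I by [].
have iI : i \in val I by rewrite /= !inE eqxx.
have [l il] := ksubset_elt_surj iI.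
(* Deleting i leaves [J] in increasing order, so both column expansions have the same minors. *)
have eltI b : ksubset_elt I (lift l b) = ksubset_elt J b.
  move: b; apply: increasing_uniq => [b b' bb'|b b' bb'|k].
  - apply: ksubset_elt_mono; rewrite /= ltnNge leq_bump2 -ltnNge //.
  - exact: ksubset_elt_mono.
  - split=> [[b ->]|[b ->]].
      have := ksubset_elt_in I (lift l b); rewrite /= !inE => /orP[/eqP h|].
        by have /eqP := neq_lift l b; case; apply: (@ksubset_elt_inj _ _ I); rewrite h.
      by move=> /ksubset_elt_surj[b' ->]; exists b'.
    have : ksubset_elt J b \in val I by rewrite /= !inE ksubset_elt_in orbT.
    move=> /ksubset_elt_surj[b' hb']; case: (unliftP l b') => [b'' b''E|b'l].
      by exists b''; rewrite hb' b''E.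
    by have := ksubset_elt_in J b; rewrite hb' b'l -il (negbTE iJ).
rewrite ext_at_val {1}il ksubset_pos_elt /ext_coord (expand_det_col _ l).
rewrite bordered_detE -sumrN mulr_sumr; apply: eq_bigr => k _.
rewrite mxE -il /cofactor /bordered_cofactor.
have -> : row' k (col' l (\matrix_(k, l) v k (ksubset_elt I l))) =
    \matrix_(a < q, b < q) v (lift k a) (ksubset_elt J b).
  by apply/matrixP => a b; rewrite !mxE eltI.
rewrite mulrCA -mulrN; congr (_ * _); rewrite mulrA -exprD.
by rewrite addnCA addSn addnn exprD exprS -[_ ^+ _.*2]signr_odd odd_double
  expr0 mulr1 mulrN1 mulNr.
Qed.

(** As the cofactors do not depend on i, the sum over i applies row j of A to each v_k. *)
Lemma ext_coord_kernel (v : 'I_q.+1 -> {ffun 'I_n -> L}) :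
  (forall k j, \sum_i (A j i)%:F * v k i = 0) ->
  forall Jj, \sum_I (ext_matrix q.+1 A Jj I)%:F * ext_coord v I = 0.
Proof.
move=> vA [J j]; rewrite ext_matrix_sum.
under eq_bigr => i _ do rewrite ext_at_coord bordered_detE mulrN mulr_sumr.
rewrite sumrN exchange_big /= big1 ?oppr0 // => k _.
under eq_bigr => i _ do rewrite mulrA.
by rewrite -mulr_suml vA mul0r.
Qed.

Lemma ext_kernel_determined B C (s : ksubset n q.+1 -> L) : kernel_graph_of A B C ->
  (forall Jj, \sum_I (ext_matrix q.+1 A Jj I)%:F * s I = 0) ->
  (forall I, (forall k, ksubset_elt I k \in B) -> s I = 0) -> forall I, s I = 0.
Proof.
move=> [_ hker] sA sB I.
have [k] := ubnP #|(val I :\: B)%SET|; elim: k I => // k IH I; rewrite ltnS => NI.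
have [[i]|h] := pselect (exists i, i \in (val I :\: B)%SET); last first.
  apply: sB => l; apply: contrapT => /negP lB; apply: h.
  by exists (ksubset_elt I l); rewrite inE lB ksubset_elt_in.
move=> iIB; have := iIB; rewrite inE => /andP[iB iI].
have cJ : #|(val I :\ i)%SET| == q.
  have := cardsD1 i (val I); rewrite iI (eqP (valP I)) add1n.
  by case=> h; apply/eqP/esym.
pose J : ksubset n q := exist (fun I : {set 'I_n} => #|I| == q) _ cJ.
have IJ : val I = (i |: val J)%SET by rewrite /= finset.setD1K.
pose w i := (-1) ^+ ksubset_pos i (i |: val J)%SET * ext_at s (i |: val J)%SET.
have wA j : \sum_i (A j i)%:F * w i = 0 by rewrite -ext_matrix_sum.
have := (hker w).1 wA i; rewrite big1 => [/eqP|i' i'B].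
  by rewrite mulf_eq0 signr_eq0 /= -IJ ext_at_val => /eqP.
(* Such an [I'] trades i for an element of [B]; there is none when i' is already in [J]. *)
rewrite /w /ext_at big1 ?mulr0 // => I' /eqP I'E; apply: IH.
apply: leq_trans NI; rewrite [X in (_ < X)%N](cardsD1 i) iIB add1n ltnS.
apply: subset_leq_card; apply/fintype.subsetP => x; rewrite I'E /= !inE.
by move=> /andP[xB /orP[/eqP xi|/andP[-> ->]]]; [rewrite xi i'B in xB|rewrite xB].
Qed.

(** For equal subsets the matrix is diagonal; otherwise some element of [I] is outside [I'], and its
    row is zero. *)
Lemma ext_coord_word (B : {set 'I_n}) (v : 'I_n -> {ffun 'I_n -> L}) x :
  (forall i k, i \in B -> k \in B -> v i k = (i == k)%:R * x i) ->
  forall I I', (forall k, ksubset_elt I k \in B) -> (forall k, ksubset_elt I' k \in B) ->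
  ext_coord (fun k => v (ksubset_elt I k)) I' = (I == I')%:R * \prod_k x (ksubset_elt I k).
Proof.
move=> vx I I' IB I'B; have [II'|II'] := eqVneq I I'.
  subst I'; rewrite mul1r /ext_coord.
  rewrite (_ : \matrix_(k, l) _ = diag_mx (\row_k x (ksubset_elt I k))).
    by rewrite det_diag; apply: eq_bigr => k _; rewrite mxE.
  apply/matrixP => k l; rewrite !mxE vx // (inj_eq (@ksubset_elt_inj _ _ I)).
  by rewrite mulr_natl.
have [k kI'] : exists k, ksubset_elt I k \notin val I'.
  apply: contrapT => h; case/eqP: II'; apply: val_inj; apply/eqP.
  rewrite eqEcard (eqP (valP I)) (eqP (valP I')) leqnn andbT.
  apply/fintype.subsetP => i /ksubset_elt_surj[l ->].
  by apply: contrapT => /negP h'; apply: h; exists l.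
rewrite mul0r /ext_coord (expand_det_row _ k) big1 // => l _.
rewrite mxE vx //; case: eqP => [kl|_]; last by rewrite !mul0r.
by rewrite kl ksubset_elt_in in kI'.
Qed.

(** A repeated letter kills the product; distinct letters form a subset, and sorting them changes
    only the coefficient. *)
Lemma ext_power_word (R : comPzRingType) (N : lmodType R) (phi : 'I_n -> N) r
    (g : 'I_q.+1 -> 'I_n) :
  power_eq ExtPower [:: (r, [ffun k => phi (g k)])] [::] \/
  exists (I : ksubset n q.+1) r', (forall k, exists k', ksubset_elt I k = g k') /\
    power_eq ExtPower [:: (r, [ffun k => phi (g k)])]
                [:: (r', [ffun k => phi (ksubset_elt I k)])].
Proof.
have [/injectiveP ginj|/injectivePn[k [l kl gkl]]] := boolP (injectiveb g); last first.
  by left; apply: (power_alt _ _ kl) => //; rewrite !ffunE gkl.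
right; have cI : #|[set g k | k : 'I_q.+1]%SET| == q.+1.
  by rewrite card_imset // card_ord.
pose I : ksubset n q.+1 := exist (fun I : {set 'I_n} => #|I| == q.+1) _ cI.
have [k|s hs] := @fin_all_exists 'I_q.+1 (fun=> 'I_q.+1) (fun k l => g k = ksubset_elt I l).
  by apply: ksubset_elt_surj; rewrite /= imset_f.
have sinj : injective s by move=> k l e'; apply: ginj; rewrite !hs e'.
have [r' h] := power_eq_perm r [ffun k => phi (ksubset_elt I k)] (perm sinj).
exists I, r'; split=> [k|].
  by have /imsetP[k' _ ->] := ksubset_elt_in I k; exists k'.
apply: power_trans h.
have -> : [ffun k => [ffun k => phi (ksubset_elt I k)] (perm sinj k)] =
    [ffun k => phi (g k)] by apply/ffunP => k; rewrite !ffunE permE hs.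
exact: power_refl.
Qed.

Lemma ext_degree (I : ksubset n q.+1) :
  ext_twists q.+1 e I = - \sum_k e (ksubset_elt I k).
Proof.
rewrite /ext_twists; congr (- _).
rewrite -(big_imset (h := ksubset_elt I) (A := predT) e) /=; last first.
  by move=> k l _ _; apply: ksubset_elt_inj.
apply: eq_bigl => i; apply/idP/imsetP => [/ksubset_elt_surj[l ->]|[l _ ->]].
  by exists l.
exact: ksubset_elt_in.
Qed.

Lemma ext_power_bij (U : opens (proj_space S)) :
  set_bij (ext_sheaf q.+1 e A U) (mxker (ext_twists q.+1 e) (ext_matrix q.+1 A) U)
    (ext_map q.+1 e A).
Proof.
have -> : ext_twists q.+1 e = fun I => - \sum_k e (ksubset_elt I k).
  by apply/funext => I; rewrite ext_degree.
apply: (power_sheaf_bij nS dimS hA (G := ext_coord)).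
- by move=> V t u; apply: ext_coords_eq.
- move=> V v I; apply: twist_bigsum => s _.
  have -> : - \sum_k e (ksubset_elt I k) = \sum_k - e (ksubset_elt I (s k)).
    by rewrite sumrN (reindex_inj (@perm_inj _ s)).
  have : twist (\sum_k - e (ksubset_elt I (s k))) (ocar V)
      (fun p => \prod_k val (v k) p (ksubset_elt I (s k))).
    apply: (@twist_prod _ _ _ q.+1 (fun k => - e (ksubset_elt I (s k)))
      (fun k p => val (v k) p (ksubset_elt I (s k)))) => // k.
    by have [] := kersecP (v k).
  case: (odd_perm s) => [/twistN|]; congr (twist _ _ _); apply/funext => p.
    by rewrite expr1 mulN1r; congr (- _); apply: eq_bigr => k _; rewrite mxE.
  by rewrite expr0 mul1r; apply: eq_bigr => k _; rewrite mxE.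
- exact: ext_coord_kernel.
- exact: ext_kernel_determined.
- exact: ext_coord_word.
- exact: ext_power_word.
Qed.

End ExteriorPower.

Theorem lemma5p4 (K : fieldType) (S : standardGradedDomain K) (n m q : nat)
    (e : 'I_n -> int) (d : 'I_m -> int) (A : 'M[S]_(m, n)) :
  [pchar K] =i pred0 ->
  is_normal S -> krull_dim S 2 -> smooth_curve S ->
  (0 < n)%N -> (0 < m)%N -> (0 < q)%N ->
  (forall j i, hpart (e i - d j) (A j i)) ->
  (forall U : opens (proj_space S),
     set_bij (sym_sheaf q e A U) (mxker (sym_twists q e) (sym_matrix q A) U)
             (sym_map q e A)) /\
  (forall U : opens (proj_space S),
     set_bij (ext_sheaf q e A U) (mxker (ext_twists q e) (ext_matrix q A) U)
             (ext_map q e A)).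
Proof.
move=> K0 nS dimS _ _ _ q0 hA; split=> U; first exact: (sym_power_bij K0 nS dimS hA).
by case: q q0 => // q' _; apply: (ext_power_bij nS dimS q' hA).
Qed.
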